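(* Let $(M,g,\phi,\xi,\eta)$ be a nearly Sasakian manifold with $\dim M\ge 7$. Then $(M,g,\phi,\xi,\eta)$ is a Sasakian manifold.
   Context: All manifolds and tensors are smooth; $\nabla$ is the Levi-Civita connection of $g$. An almost contact metric manifold is a tuple $(M^{2n+1},g,\phi,\xi,\eta)$ where $M$ is a manifold of dimension $2n+1$, $g$ is a Riemannian metric on $M$, $\phi$ is a $(1,1)$-tensor (a field of endomorphisms of $TM$), $\xi$ is a vector field and $\eta$ is a $1$-form such that: (i) $\phi^2X=-X+\eta(X)\xi$ for all vector fields $X$; (ii) $\eta(X)=g(X,\xi)$ for all $X$, and $g(\xi,\xi)=1$; (iii) $\phi$ is skew-symmetric: $g(\phi X,Y)=-g(X,\phi Y)$ for all $X,Y$. A nearly Sasakian manifold is an almost contact metric manifold such that $(\nabla_X\phi)X=g(X,X)\xi-\eta(X)X$ for all vector fields $X$. A Sasakian manifold is an almost contact metric manifold such that $(\nabla_X\phi)Y=g(X,Y)\xi-\eta(Y)X$ for all vector fields $X,Y$. *)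

(* Defs.v *)
From HB Require Import structures.
From mathcomp Require Import all_boot all_order all_algebra.
From mathcomp Require Import all_classical all_reals all_analysis.
Set Implicit Arguments.
Unset Strict Implicit.
Unset Printing Implicit Defensive.
Import Order.TTheory GRing.Theory Num.Theory.
Import numFieldNormedType.Exports.
Local Open Scope classical_set_scope.
Local Open Scope ring_scope.

(* Only meaningful for U open: C^k.+1 asks for Frechet differentiability on U
   and for every directional derivative to be C^k on U; the values of f
   outside U do not matter. *)
Fixpoint Ck_on (R : realType) (V W : normedModType R) (U : set V) (k : nat)
    (f : V -> W) : Prop :=
  match k with
  | 0 => forall x, U x -> {for x, continuous f}
  | k'.+1 => (forall x, U x -> differentiable f x) /\
             (forall v : V, Ck_on U k' ('D_v f))
  end.

Definition smooth_on (R : realType) (V W : normedModType R) (U : set V)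
    (f : V -> W) : Prop :=
  forall k, Ck_on U k f.

Record chart (R : realType) (m : nat) (T : topologicalType) := Chart {
  cdom : set T;
  cmap :> T -> 'rV[R]_m;
  cinv : 'rV[R]_m -> T;  (* arbitrary outside the image of cdom *)
  cdom_open : open cdom;
  cimg_open : open (cmap @` cdom);
  cmapK : forall p, cdom p -> cinv (cmap p) = p;
  cmap_continuous : forall p, cdom p -> {for p, continuous cmap};
  cinv_continuous : forall x, (cmap @` cdom) x -> {for x, continuous cinv}
}.

Record manifold (R : realType) (m : nat) := Manifold {
  mcarrier :> topologicalType;
  manifold_hausdorff : hausdorff_space mcarrier;
  manifold_second_countable : @second_countable mcarrier;
  atlas : set (chart R m mcarrier);
  chart_at : mcarrier -> chart R m mcarrier;
  chart_at_atlas : forall p, atlas (chart_at p);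
  chart_at_dom : forall p, cdom (chart_at p) p;
  atlas_smooth : forall c c', atlas c -> atlas c' ->
    smooth_on (c @` (cdom c `&` cdom c')) (c' \o cinv c)
}.

Section Tensors.
Variables (R : realType) (m : nat) (M : manifold R m).

(* T_pM is represented by 'rV[R]_m, a tangent vector being given by its
   components in the preferred chart chart_at p.  Since chart_at varies
   arbitrarily with p, smoothness of sections is never read off from these
   values directly, but from the components in each fixed chart of the atlas,
   obtained through the differential of the change of coordinates. *)
Notation tangent := 'rV[R]_m (only parsing).

(* components in the chart c of v in T_pM, i.e. dc_p(v) *)
Definition components (c : chart R m M) (p : M) (v : tangent) : 'rV[R]_m :=
  'd (c \o cinv (chart_at p)) (chart_at p p) v.

(* inverse of the previous map: the vector of T_pM with components e in c *)
Definition of_components (c : chart R m M) (p : M) (e : 'rV[R]_m) : tangent :=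
  'd (chart_at p \o cinv c) (c p) e.

Definition smooth_fun (f : M -> R) : Prop :=
  forall c, atlas c -> smooth_on (c @` cdom c) (f \o cinv c).

Definition smooth_vfield (X : M -> tangent) : Prop :=
  forall c, atlas c ->
    smooth_on (c @` cdom c) ((fun p => components c p (X p)) \o cinv c).

Definition smooth_1form (eta : M -> {scalar tangent}) : Prop :=
  forall c, atlas c -> forall e : 'rV[R]_m,
    smooth_on (c @` cdom c)
      ((fun p => eta p (of_components c p e)) \o cinv c).

Definition smooth_endo (phi : M -> {linear tangent -> tangent}) : Prop :=
  forall c, atlas c -> forall e : 'rV[R]_m,
    smooth_on (c @` cdom c)
      ((fun p => components c p (phi p (of_components c p e))) \o cinv c).

Record riemannian_metric (g : M -> tangent -> tangent -> R) : Prop := {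
  metric_linear : forall p u, scalar (g p u);
  metric_sym : forall p u v, g p u v = g p v u;
  metric_pos : forall p u, u != 0 -> 0 < g p u u;
  metric_smooth : forall c, atlas c -> forall e e' : 'rV[R]_m,
    smooth_on (c @` cdom c)
      ((fun p => g p (of_components c p e) (of_components c p e')) \o cinv c)
}.

(* the function X f *)
Definition dirder (X : M -> tangent) (f : M -> R) : M -> R :=
  fun p => 'd (f \o cinv (chart_at p) : 'rV[R]_m -> R) (chart_at p p) (X p).

Record affine_connection
    (nabla : (M -> tangent) -> (M -> tangent) -> M -> tangent) : Prop := {
  conn_smooth : forall X Y, smooth_vfield X -> smooth_vfield Y ->
    smooth_vfield (nabla X Y);
  conn_linear : forall f X Y Z, smooth_fun f ->
    smooth_vfield X -> smooth_vfield Y -> smooth_vfield Z ->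
    forall p, nabla (fun q => f q *: X q + Y q) Z p
              = f p *: nabla X Z p + nabla Y Z p;
  conn_additive : forall X Y Z,
    smooth_vfield X -> smooth_vfield Y -> smooth_vfield Z ->
    forall p, nabla X (fun q => Y q + Z q) p = nabla X Y p + nabla X Z p;
  conn_leibniz : forall f X Y, smooth_fun f ->
    smooth_vfield X -> smooth_vfield Y ->
    forall p, nabla X (fun q => f q *: Y q) p
              = dirder X f p *: Y p + f p *: nabla X Y p
}.

(* lc_torsion_free is nabla_X Y - nabla_Y X = [X, Y], with the bracket given
   by its action [X, Y] f = X (Y f) - Y (X f) on smooth functions. *)
Record levi_civita (g : M -> tangent -> tangent -> R)
    (nabla : (M -> tangent) -> (M -> tangent) -> M -> tangent) : Prop := {
  lc_connection : affine_connection nabla;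
  lc_torsion_free : forall X Y f,
    smooth_vfield X -> smooth_vfield Y -> smooth_fun f ->
    forall p, dirder (fun q => nabla X Y q - nabla Y X q) f p
              = dirder X (dirder Y f) p - dirder Y (dirder X f) p;
  lc_metric : forall X Y Z,
    smooth_vfield X -> smooth_vfield Y -> smooth_vfield Z ->
    forall p, dirder X (fun q => g q (Y q) (Z q)) p
              = g p (nabla X Y p) (Z p) + g p (Y p) (nabla X Z p)
}.

(* (nabla_X phi) Y *)
Definition nabla_endo
    (nabla : (M -> tangent) -> (M -> tangent) -> M -> tangent)
    (phi : M -> {linear tangent -> tangent}) (X Y : M -> tangent) :
    M -> tangent :=
  fun p => nabla X (fun q => phi q (Y q)) p - phi p (nabla X Y p).

End Tensors.

Section Structures.
Variables (R : realType) (n : nat) (M : manifold R (2 * n).+1).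
Notation tangent := 'rV[R]_((2 * n).+1) (only parsing).
Variables (g : M -> tangent -> tangent -> R)
  (phi : M -> {linear tangent -> tangent})
  (xi : M -> tangent) (eta : M -> {scalar tangent}).

Record almost_contact_metric : Prop := {
  acm_metric : riemannian_metric g;
  acm_phi_smooth : smooth_endo phi;
  acm_xi_smooth : smooth_vfield xi;
  acm_eta_smooth : smooth_1form eta;
  acm_phi2 : forall X, smooth_vfield X ->
    forall p, phi p (phi p (X p)) = - X p + eta p (X p) *: xi p;
  acm_eta : forall X, smooth_vfield X ->
    forall p, eta p (X p) = g p (X p) (xi p);
  acm_xi_unit : forall p, g p (xi p) (xi p) = 1;
  acm_phi_skew : forall X Y, smooth_vfield X -> smooth_vfield Y ->
    forall p, g p (phi p (X p)) (Y p) = - g p (X p) (phi p (Y p))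
}.

(* In the next two definitions nabla is meant to be the Levi-Civita connection
   of g. *)
Definition nearly_sasakian
    (nabla : (M -> tangent) -> (M -> tangent) -> M -> tangent) : Prop :=
  almost_contact_metric /\
  forall X, smooth_vfield X -> forall p,
    nabla_endo nabla phi X X p = g p (X p) (X p) *: xi p - eta p (X p) *: X p.

Definition sasakian
    (nabla : (M -> tangent) -> (M -> tangent) -> M -> tangent) : Prop :=
  almost_contact_metric /\
  forall X Y, smooth_vfield X -> smooth_vfield Y -> forall p,
    nabla_endo nabla phi X Y p = g p (X p) (Y p) *: xi p - eta p (Y p) *: X p.

End Structures.

(* Main.v *)
Require Import Defs.
From HB Require Import structures.
From mathcomp Require Import all_boot all_order all_algebra.
From mathcomp Require Import all_classical all_reals all_analysis.
From mathcomp Require Import ring lra.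
Set Implicit Arguments.
Unset Strict Implicit.
Unset Printing Implicit Defensive.
Import Order.TTheory GRing.Theory Num.Theory.
Import numFieldNormedType.Exports.
Local Open Scope ring_scope.

(** Let S(X, Y, Z) = g((nabla_X phi) Y - g(X, Y) xi + eta(Y) X, Z) measure the
deviation from the Sasakian condition, so that S = 0 is to be shown.  Skewness
of phi makes S skew in Y and Z, and the nearly Sasakian condition makes it skew
in X and Y.  So S is a 3-form, and d Phi = 3 S for the 2-form
Phi = g(phi ., .).  Let C = nabla_xi phi, the contraction of S with xi.

Differentiating phi xi = 0 and phi^2 = - 1 + eta xi gives
nabla xi = - phi C - phi and phi C = - C phi ([AE], [C_phi]).  Hence nabla xi is
skew and xi is a Killing field, so the Lie derivative along xi commutes with
nabla ([killing_nabla]).  It sends phi to 3 C; applied to the nearly Sasakian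
identity it shows that nabla C is totally skew ([cov_der_C_skew12]).

On fields orthogonal to xi two linear relations connect S and nabla C: the
derivative of phi C + C phi = 0 ([cov_der_C_phi]), and d d eta = 0 written out
with d eta = 2 g(nabla xi, .) ([dev_cyclic_sum]).  Since phi, and then phi C,
can be moved from one slot of S to another, while C anticommutes with phi,
these relations force S(C X, Y, Z) = 0 and g((nabla_X C) Y, Z) = - S(phi X, Y,
Z) there ([dev_C], [cov_der_CE]).  The first identity says that S takes values
in the kernel of C, the second that S(X, Y, Z) vanishes when C Y = C Z = 0
([dev_kerC]).  Together they give S = 0 on fields orthogonal to xi
([dev_horizontal]), that is, S = eta /\ C ([dev_wedge]).

Now 0 = d d Phi = 3 d (eta /\ C) yields d eta /\ C = 0 orthogonally to xi
([A_wedge_C]).  Evaluated at X, phi X, Z, W with X orthogonal to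
xi, Z, W, phi Z and phi W, this reads |X|^2 g(C Z, W) = 0 ([C_eq0]).  Five
linear conditions leave a nonzero X in a space of dimension at least 7, so
C = 0 and S = 0.

The argument uses functions and vector fields only through algebraic rules, so
it is carried out for a module V over a ring F that carries a metric and a
Levi-Civita connection.  Smooth vector fields over smooth functions are such a
module.  This needs the stability of smoothness under the operations involved,
and enough global objects: every tangent vector is a value of a smooth field
([vfield_through]), and a field is determined by its action on smooth functions
([dirder_inj]).  Both come from bump functions supported in a chart. *)

(** * Modules with a Levi-Civita connection *)

(** F stands for the ring of functions on the set P of points, V for the module
of vector fields, and D X f for the derivative of f along X.  The evaluations ev
are kept, rather than F alone, because identities between functions can then be
checked in an ordered field. *)
Section LeviCivitaModule.
Variables (R : realFieldType) (P : Type) (F : comPzRingType).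
Variable ev : P -> {rmorphism F -> R}.
Hypothesis ev_inj : forall a b : F, (forall p, ev p a = ev p b) -> a = b.
Variables (V : lmodType F) (D : V -> F -> F) (nabla : V -> V -> V).
Variable g : V -> V -> F.
Hypothesis derDl : forall X Y f, D (X + Y) f = D X f + D Y f.
Hypothesis derDr : forall X f f', D X (f + f') = D X f + D X f'.
Hypothesis derM : forall X f f', D X (f * f') = D X f * f' + f * D X f'.
Hypothesis der_inj : forall X Y, (forall f, D X f = D Y f) -> X = Y.
Hypothesis nablaDl : forall X Y Z, nabla (X + Y) Z = nabla X Z + nabla Y Z.
Hypothesis nablaZl : forall f X Y, nabla (f *: X) Y = f *: nabla X Y.
Hypothesis nablaDr : forall X Y Z, nabla X (Y + Z) = nabla X Y + nabla X Z.
Hypothesis nablaZr :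
  forall f X Y, nabla X (f *: Y) = D X f *: Y + f *: nabla X Y.
Hypothesis torsion_free : forall X Y f,
  D (nabla X Y - nabla Y X) f = D X (D Y f) - D Y (D X f).
Hypothesis gDl : forall X Y Z, g (X + Y) Z = g X Z + g Y Z.
Hypothesis gZl : forall f X Y, g (f *: X) Y = f * g X Y.
Hypothesis g_sym : forall X Y, g X Y = g Y X.
Hypothesis g_definite : forall X, g X X = 0 -> X = 0.
Hypothesis nabla_metric : forall X Y Z,
  D X (g Y Z) = g (nabla X Y) Z + g Y (nabla X Z).

(** Reduces an identity in F to its values at the points of P, where it follows
by linear arithmetic from the equations before it and in the context. *)
Ltac by_points := lazymatch goal with
  | |- (_ = _) -> _ => let H := fresh "eqn" in intro H; by_points
  | |- _ =>
    apply: ev_inj; let p := fresh "p" in intro p;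
    repeat match goal with
    | H : @eq _ _ _ |- _ =>
      generalize (congr1 (ev p) H); clear H
    end;
    intros; lra
  end.

Lemma additive0 (U W : zmodType) (f : U -> W) :
  (forall x y, f (x + y) = f x + f y) -> f 0 = 0.
Proof. by move=> fD; apply: (addrI (f 0)); rewrite -fD !addr0. Qed.

Lemma additiveN (U W : zmodType) (f : U -> W) :
  (forall x y, f (x + y) = f x + f y) -> forall x, f (- x) = - f x.
Proof.
by move=> fD x; apply: (addrI (f x)); rewrite -fD !subrr (additive0 fD).
Qed.

Lemma derN X f : D X (- f) = - D X f.
Proof. exact: (additiveN (derDr X)). Qed.
Lemma derNl X f : D (- X) f = - D X f.
Proof. by apply: (additiveN (f := D^~ f)) => x y; rewrite derDl. Qed.
Lemma derB X f f' : D X (f - f') = D X f - D X f'.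
Proof. by rewrite derDr derN. Qed.
Lemma derBl X Y f : D (X - Y) f = D X f - D Y f.
Proof. by rewrite derDl derNl. Qed.
Lemma der1 X : D X 1 = 0.
Proof. by have := derM X 1 1; rewrite !mulr1 mul1r; by_points. Qed.
Lemma der0 X : D X 0 = 0. Proof. exact: (additive0 (derDr X)). Qed.

Lemma gNl X Y : g (- X) Y = - g X Y.
Proof. by apply: (additiveN (f := g^~ Y)) => x y; rewrite gDl. Qed.
Lemma gDr X Y Z : g X (Y + Z) = g X Y + g X Z.
Proof. by rewrite ![g X _]g_sym gDl. Qed.
Lemma gNr X Y : g X (- Y) = - g X Y.
Proof. by rewrite ![g X _]g_sym gNl. Qed.
Lemma gZr f X Y : g X (f *: Y) = f * g X Y.
Proof. by rewrite ![g X _]g_sym gZl. Qed.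
Lemma g0l X : g 0 X = 0.
Proof. by apply: (additive0 (f := g^~ X)) => x y; rewrite gDl. Qed.
Lemma g0r X : g X 0 = 0. Proof. by rewrite g_sym g0l. Qed.
Definition gE := (gDl, gDr, gNl, gNr, gZl, gZr, g0l, g0r).

Lemma g_inj X Y : (forall Z, g X Z = g Y Z) -> X = Y.
Proof.
move=> XY; apply/subr0_eq/g_definite.
by rewrite [LHS]gDl gNl XY subrr.
Qed.

Lemma nablaNl X Y : nabla (- X) Y = - nabla X Y.
Proof. by apply: (additiveN (f := nabla^~ Y)) => x y; rewrite nablaDl. Qed.
Lemma nablaNr X Y : nabla X (- Y) = - nabla X Y.
Proof. exact: (additiveN (nablaDr X)). Qed.
Lemma nabla0r X : nabla X 0 = 0.
Proof. exact: (additive0 (nablaDr X)). Qed.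
Definition nablaE := (nablaDl, nablaDr, nablaNl, nablaNr, nablaZl, nablaZr).

(** Locked, so that the linearity rules [gE] do not rewrite inside a bracket;
[cov_der] and [dev] below are locked for the same reason. *)
Definition bracket X Y := locked (nabla X Y - nabla Y X).

Lemma bracketE X Y : bracket X Y = nabla X Y - nabla Y X.
Proof. by rewrite /bracket -lock. Qed.

Lemma bracketDr X Y Z : bracket X (Y + Z) = bracket X Y + bracket X Z.
Proof. by rewrite !bracketE !nablaE opprD addrACA. Qed.

Lemma bracketNr X Y : bracket X (- Y) = - bracket X Y.
Proof. exact: (additiveN (bracketDr X)). Qed.

Lemma bracketZr f X Y : bracket X (f *: Y) = D X f *: Y + f *: bracket X Y.
Proof. by rewrite !bracketE !nablaE scalerBr addrA. Qed.

Lemma bracketC X Y : bracket Y X = - bracket X Y.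
Proof. by rewrite !bracketE opprB. Qed.

Lemma der_bracket X Y f : D (bracket X Y) f = D X (D Y f) - D Y (D X f).
Proof. by rewrite bracketE torsion_free. Qed.

(** Fields are determined by their action on functions, where the bracket is a
commutator. *)
Lemma jacobi X Y Z : bracket (bracket X Y) Z =
  bracket X (bracket Y Z) - bracket Y (bracket X Z).
Proof.
apply: der_inj => f.
by rewrite [in RHS]derBl !der_bracket !derB; by_points.
Qed.

(** * Exterior derivative *)

(** The Cartan formulas in degrees 1, 2 and 3, without normalizing factors. *)
Definition ext1 (al : V -> F) X Y := D X (al Y) - D Y (al X) - al (bracket X Y).

Definition ext2 (w : V -> V -> F) X Y Z :=
  D X (w Y Z) - D Y (w X Z) + D Z (w X Y)
  - w (bracket X Y) Z + w (bracket X Z) Y - w (bracket Y Z) X.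

Definition ext3 (s : V -> V -> V -> F) X Y Z W :=
  D X (s Y Z W) - D Y (s X Z W) + D Z (s X Y W) - D W (s X Y Z)
  - s (bracket X Y) Z W + s (bracket X Z) Y W - s (bracket X W) Y Z
  - s (bracket Y Z) X W + s (bracket Y W) X Z - s (bracket Z W) X Y.

Lemma ext2_ext1 al : (forall X Y, al (X + Y) = al X + al Y) ->
  forall X Y Z, ext2 (ext1 al) X Y Z = 0.
Proof.
move=> alD X Y Z; rewrite /ext2 /ext1 !(derDr, derN) !der_bracket.
rewrite (jacobi X Y Z) (bracketC X (bracket Y Z)) (bracketC Y (bracket X Z)).
by rewrite alD !(additiveN alD); by_points.
Qed.

Lemma ext3_ext2 w : (forall X Y Z, w (X + Y) Z = w X Z + w Y Z) ->
  (forall X Y, w Y X = - w X Y) ->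
  forall X Y Z W, ext3 (ext2 w) X Y Z W = 0.
Proof.
move=> wDl wC X Y Z W.
have wNl U T : w (- U) T = - w U T.
  by apply: (additiveN (f := w^~ T)) => x y; rewrite wDl.
rewrite /ext3 /ext2 !(derDr, derN) !der_bracket.
have J U T S Q : w (bracket (bracket U T) S) Q - w (bracket (bracket U S) T) Q
    + w (bracket (bracket T S) U) Q = 0.
  rewrite (jacobi U T S) (bracketC T (bracket U S)) (bracketC U (bracket T S)).
  by rewrite wDl !wNl; by_points.
(* The derivatives have cancelled.  What remains is a Jacobi identity for each
   triple among the four fields, paired with the fourth field, and values of w
   at two brackets, which cancel by skewness. *)
transitivity ((w (bracket (bracket X Y) Z) W - w (bracket (bracket X Z) Y) W
    + w (bracket (bracket Y Z) X) W)
  - (w (bracket (bracket X Y) W) Z - w (bracket (bracket X W) Y) Z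
    + w (bracket (bracket Y W) X) Z)
  + (w (bracket (bracket X Z) W) Y - w (bracket (bracket X W) Z) Y
    + w (bracket (bracket Z W) X) Y)
  - (w (bracket (bracket Y Z) W) X - w (bracket (bracket Y W) Z) X
    + w (bracket (bracket Z W) Y) X)); last by rewrite !J !(subr0, addr0).
rewrite (wC (bracket X Y) (bracket Z W)) (wC (bracket X Z) (bracket Y W)).
rewrite (wC (bracket X W) (bracket Y Z)).
ring.
Qed.

(** The Leibniz rule d (al /\ w) = d al /\ w - al /\ d w at arguments that
annihilate al, where its second term vanishes. *)
Lemma ext3_wedge (al : V -> F) w :
  (forall X Y, w Y X = - w X Y) ->
  forall X Y Z W, al X = 0 -> al Y = 0 -> al Z = 0 -> al W = 0 ->
  ext3 (fun X Y Z => al X * w Y Z - al Y * w X Z + al Z * w X Y) X Y Z W =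
  ext1 al X Y * w Z W - ext1 al X Z * w Y W + ext1 al X W * w Y Z
  + ext1 al Y Z * w X W - ext1 al Y W * w X Z + ext1 al Z W * w X Y.
Proof.
move=> wC X Y Z W X0 Y0 Z0 W0; rewrite /ext3 /ext1 !(derDr, derN) !derM.
rewrite X0 Y0 Z0 W0 !der0.
by_points.
Qed.

(** * Skew endomorphisms *)

(** The covariant derivative (nabla_X T) Y of an endomorphism T. *)
Definition cov_der (T : V -> V) X Y := locked (nabla X (T Y) - T (nabla X Y)).

Lemma cov_derE T X Y : cov_der T X Y = nabla X (T Y) - T (nabla X Y).
Proof. by rewrite /cov_der -lock. Qed.

Definition skew_endo (T : V -> V) := forall X Y, g (T X) Y = - g X (T Y).

(** Skewness forces linearity, because g is nondegenerate. *)
Lemma skew_endoD T : skew_endo T -> forall X Y, T (X + Y) = T X + T Y.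
Proof.
by move=> Tsk X Y; apply: g_inj => Z; rewrite !gE !Tsk !gE; by_points.
Qed.

Lemma skew_endoZ T : skew_endo T -> forall f X, T (f *: X) = f *: T X.
Proof.
by move=> Tsk f X; apply: g_inj => Z; rewrite !gE !Tsk !gE; by_points.
Qed.

Lemma skew_endoN T : skew_endo T -> forall X, T (- X) = - T X.
Proof. by move=> Tsk; apply: additiveN; exact: skew_endoD. Qed.

Lemma cov_der_skew T : skew_endo T ->
  forall X Y Z, g (cov_der T X Y) Z = - g (cov_der T X Z) Y.
Proof.
move=> Tsk X Y Z; rewrite (g_sym (cov_der T X Z)) !cov_derE !gE.
move: (nabla_metric X (T Y) Z) (nabla_metric X Y (T Z)).
rewrite (Tsk Y Z) derN (Tsk (nabla X Y) Z) (Tsk Y (nabla X Z)).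
by_points.
Qed.

(** Without torsion, the brackets in the Cartan formula combine with the
derivatives into covariant derivatives. *)
Lemma ext2_skew T : skew_endo T -> forall X Y Z,
  ext2 (fun X Y => g (T X) Y) X Y Z =
  g (cov_der T X Y) Z + g (cov_der T Y Z) X + g (cov_der T Z X) Y.
Proof.
move=> Tsk X Y Z; rewrite /ext2 !bracketE !cov_derE !nabla_metric.
rewrite !(skew_endoD Tsk) !(skew_endoN Tsk) !gE.
move: (Tsk (nabla Y X) Z) (Tsk (nabla Z X) Y) (Tsk (nabla Z Y) X).
move: (Tsk (nabla X Y) Z) (Tsk (nabla X Z) Y) (Tsk (nabla Y Z) X).
move: (Tsk X (nabla Y Z)) (Tsk X (nabla Z Y)) (Tsk Y (nabla X Z)).
move: (Tsk Y (nabla Z X)) (Tsk Z (nabla X Y)) (Tsk Z (nabla Y X)).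
move: (cov_der_skew Tsk Y X Z); rewrite !cov_derE !gE => H.
rewrite !(g_sym _ (T _)).
by_points.
Qed.

Lemma cov_derDl T : skew_endo T ->
  forall X Y Z, cov_der T (X + Y) Z = cov_der T X Z + cov_der T Y Z.
Proof.
move=> Tsk X Y Z; apply: g_inj => U.
by rewrite !cov_derE !nablaE !(skew_endoD Tsk) !gE; by_points.
Qed.

Lemma cov_derNl T : skew_endo T ->
  forall X Y, cov_der T (- X) Y = - cov_der T X Y.
Proof.
move=> Tsk X Y; apply: (additiveN (f := cov_der T ^~ Y)) => *.
exact: cov_derDl.
Qed.

Lemma cov_derZl T : skew_endo T ->
  forall f X Y, cov_der T (f *: X) Y = f *: cov_der T X Y.
Proof.
move=> Tsk f X Y; apply: g_inj => U.
by rewrite !cov_derE !nablaE !(skew_endoZ Tsk) !gE; by_points.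
Qed.

Lemma cov_derDr T : skew_endo T ->
  forall X Y Z, cov_der T X (Y + Z) = cov_der T X Y + cov_der T X Z.
Proof.
move=> Tsk X Y Z; apply: g_inj => U.
by rewrite !cov_derE !(skew_endoD Tsk, nablaE) !gE; by_points.
Qed.

Lemma nabla_comp T U : skew_endo T -> forall X Y,
  nabla X (T (U Y)) = cov_der T X (U Y) + T (cov_der U X Y) + T (U (nabla X Y)).
Proof.
move=> Tsk X Y; rewrite !cov_derE (skew_endoD Tsk) (skew_endoN Tsk).
by rewrite addrA !subrK.
Qed.

(** * Nearly Sasakian structures *)

Section NearlySasakian.
Variables (phi : V -> V) (xi : V).
Notation eta X := (g X xi).
Hypothesis xi_unit : g xi xi = 1.
Hypothesis phi_phi : forall X, phi (phi X) = - X + eta X *: xi.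
Hypothesis phi_skew : skew_endo phi.
Hypothesis nearly : forall X, cov_der phi X X = g X X *: xi - eta X *: X.

(** The deviation of nabla phi from the value it has on a Sasakian manifold. *)
Definition dev X Y := locked (cov_der phi X Y - (g X Y *: xi - eta Y *: X)).
Notation S X Y Z := (g (dev X Y) Z).

Lemma devE X Y : dev X Y = cov_der phi X Y - (g X Y *: xi - eta Y *: X).
Proof. by rewrite /dev -lock. Qed.

Definition xi_der_phi X := cov_der phi xi X.
Notation C := xi_der_phi.

Definition der_xi X := nabla X xi.
Notation A := der_xi.

Notation E X Y Z := (g (cov_der C X Y) Z).

Let phi0 := additive0 (skew_endoD phi_skew).
Let phiD := skew_endoD phi_skew.
Let phiN := skew_endoN phi_skew.

Lemma phi_xi : phi xi = 0.
Proof.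
apply: g_definite; rewrite phi_skew phi_phi xi_unit scale1r addNr.
by rewrite g0r oppr0.
Qed.

Lemma eta_phi X : eta (phi X) = 0.
Proof. by rewrite phi_skew phi_xi g0r oppr0. Qed.

Lemma eta_A X : eta (A X) = 0.
Proof.
have := nabla_metric X xi xi; rewrite xi_unit der1 /der_xi.
by rewrite (g_sym xi (nabla X xi)); by_points.
Qed.

Lemma dev_skew23 X Y Z : S X Y Z = - S X Z Y.
Proof.
rewrite !devE !gE; move: (cov_der_skew phi_skew X Y Z).
by rewrite (g_sym xi Z) (g_sym xi Y); by_points.
Qed.

(** Polarization of the nearly Sasakian condition. *)
Lemma dev_skew12 X Y Z : S X Y Z = - S Y X Z.
Proof.
(* The same value, by the hypothesis at X + Y and by biadditivity. *)
have : g (cov_der phi (X + Y) (X + Y)) Z =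
  g (cov_der phi (X + Y) (X + Y)) Z by [].
rewrite !devE {1}nearly (cov_derDl phi_skew) !(cov_derDr phi_skew) !nearly !gE.
by rewrite (g_sym Y X); by_points.
Qed.

Lemma C_dev X : C X = dev xi X.
Proof.
apply: g_inj => Y; rewrite /xi_der_phi devE !gE (g_sym xi X); by_points.
Qed.

Lemma dev_xi X Y : S X Y xi = g (C X) Y.
Proof.
by move: (dev_skew23 X Y xi) (dev_skew12 X xi Y); rewrite C_dev; by_points.
Qed.

Lemma C_skew : skew_endo C.
Proof. by move=> X Y; rewrite (g_sym X) !C_dev dev_skew23. Qed.

Let CD := skew_endoD C_skew.

Lemma C_xi : C xi = 0.
Proof.
by apply: g_inj => Z; rewrite g0l C_dev; move: (dev_skew12 xi xi Z); by_points.
Qed.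

Lemma eta_C X : eta (C X) = 0.
Proof. by rewrite C_skew C_xi g0r oppr0. Qed.

Lemma cov_der_phi_xi X : cov_der phi X xi = - phi (A X).
Proof. by rewrite !cov_derE phi_xi nabla0r add0r. Qed.

(** Since phi xi = 0, the value dev X xi determines phi (nabla_X xi); by the
symmetries of dev it is also given by C. *)
Lemma AE X : A X = - phi (C X) - phi X.
Proof.
have CE : C X = phi (A X + phi X).
  apply: g_inj => Y; rewrite -dev_xi dev_skew23 devE cov_der_phi_xi phiD.
  by rewrite phi_phi !gE xi_unit (g_sym xi Y); by_points.
have eta0 : eta (A X + phi X) = 0 by rewrite gDl eta_A eta_phi addr0.
by rewrite CE phi_phi eta0 scale0r addr0 opprK addrK.
Qed.

(** The derivative of phi^2 = - 1 + eta xi. *)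
Lemma cov_der_phi_phi X Y :
  cov_der phi X (phi Y) + phi (cov_der phi X Y) =
  g Y (A X) *: xi + eta Y *: A X.
Proof.
apply: g_inj => Z; move: (congr1 (g^~ Z) (nabla_comp phi phi_skew X Y)).
rewrite /= !phi_phi !nablaE !gE (nabla_metric X Y xi) /der_xi; by_points.
Qed.

Lemma dev_phi X Y Z : S X (phi Y) Z - S X Y (phi Z) =
  - g Y (phi (C X)) * eta Z - eta Y * g (phi (C X)) Z.
Proof.
have := congr1 (g^~ Z) (cov_der_phi_phi X Y); rewrite !devE /= !gE !AE !gE.
rewrite eta_phi (phi_skew (cov_der phi X Y)) (phi_skew X Z).
rewrite (g_sym xi (phi Z)) eta_phi (g_sym xi Z) (g_sym X (phi Y)).
by rewrite (phi_skew Y X); by_points.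
Qed.

(** [dev_phi] with xi in the first slot, where dev is C. *)
Lemma C_phi X : C (phi X) = - phi (C X).
Proof.
apply: g_inj => Z; move: (dev_phi xi X Z).
by rewrite -!C_dev C_xi phi0 !gE phi_skew; by_points.
Qed.

(** That is, xi is a Killing field. *)
Lemma A_skew : skew_endo A.
Proof.
move=> X Y; rewrite !AE !gE !phi_skew !C_skew !C_phi !gE.
by_points.
Qed.

Lemma ext1_eta X Y : ext1 (g^~ xi) X Y = g (A X) Y + g (A X) Y.
Proof.
rewrite /ext1 bracketE !nabla_metric !gE.
by move: (A_skew X Y); rewrite (g_sym X) (g_sym Y); by_points.
Qed.

(** * Lie derivatives along the Killing field *)

Lemma bracket_xi X : bracket xi X = nabla xi X - A X.
Proof. exact: bracketE. Qed.

Lemma killing X Y :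
  D xi (g X Y) = g (bracket xi X) Y + g X (bracket xi Y).
Proof.
rewrite !bracket_xi nabla_metric !gE; move: (A_skew X Y); by_points.
Qed.

(** The Lie derivative along xi commutes with nabla.  The defect T is symmetric
in its arguments by the Jacobi identity, and g (T X Y) Z is skew in Y and Z
since g is parallel and invariant along xi; such a T vanishes. *)
Lemma killing_nabla X Y : bracket xi (nabla X Y) =
  nabla (bracket xi X) Y + nabla X (bracket xi Y).
Proof.
pose T X Y := locked (bracket xi (nabla X Y) -
  (nabla (bracket xi X) Y + nabla X (bracket xi Y))).
have TE U W : T U W = bracket xi (nabla U W) -
  (nabla (bracket xi U) W + nabla U (bracket xi W)) by rewrite /T -lock.
have Tsym U W Z : g (T U W) Z = g (T W U) Z.
  rewrite !TE.
  have := congr1 (g^~ Z) (jacobi xi U W).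
  rewrite /= [bracket U W]bracketE bracketDr bracketNr.
  by rewrite [bracket (bracket xi U) W]bracketE (bracketE U) !gE; by_points.
have Tskew U W Z : g (T U W) Z = - g (T U Z) W.
  rewrite !TE !gE.
  have := der_bracket xi U (g W Z).
  rewrite (killing W) (nabla_metric U W) (nabla_metric (bracket xi U)).
  rewrite !derDr !killing !(nabla_metric U).
  move: (g_sym (nabla U (bracket xi Z)) W) (g_sym (nabla (bracket xi U) Z) W).
  by move: (g_sym (bracket xi (nabla U Z)) W); by_points.
apply/subr0_eq; rewrite -TE; apply: g_inj => Z; rewrite g0l.
move: (Tsym X Y Z) (Tsym X Z Y) (Tsym Y Z X).
by move: (Tskew X Y Z) (Tskew Y X Z) (Tskew Z X Y); by_points.
Qed.

(** One C is nabla_xi phi, the other two come from the commutator of phi with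
nabla xi = - phi C - phi. *)
Lemma lie_phi X : bracket xi (phi X) = phi (bracket xi X) + (C X + C X + C X).
Proof.
rewrite !bracket_xi !AE.
have -> : nabla xi (phi X) = C X + phi (nabla xi X).
  by rewrite /xi_der_phi cov_derE subrK.
rewrite !(phiD, phiN) C_phi !(phi_phi, phiN) eta_C.
by apply: g_inj => Z; rewrite !gE; by_points.
Qed.

Lemma lie_cov_der_phi X Y : bracket xi (cov_der phi X Y) =
  cov_der phi (bracket xi X) Y + cov_der phi X (bracket xi Y)
  + (cov_der C X Y + cov_der C X Y + cov_der C X Y).
Proof.
rewrite !cov_derE !bracketDr.
have -> : bracket xi (- phi (nabla X Y)) = - bracket xi (phi (nabla X Y)).
  by rewrite bracketNr.
rewrite killing_nabla !lie_phi !killing_nabla !(phiD, CD) !nablaE.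
by apply: g_inj => Z; rewrite !gE; by_points.
Qed.

Lemma nearly_polar X Y : cov_der phi X Y + cov_der phi Y X =
  (g X Y + g X Y) *: xi - eta X *: Y - eta Y *: X.
Proof.
have := nearly (X + Y).
rewrite (cov_derDl phi_skew) !(cov_derDr phi_skew) !nearly.
move=> /(congr1 (g^~ _)) H; apply: g_inj => Z; have {H} := H Z.
by rewrite !gE (g_sym Y X); by_points.
Qed.

Lemma bracket_xi_xi : bracket xi xi = 0.
Proof. by rewrite !bracketE subrr. Qed.

(** The Lie derivative along xi of the polarized nearly Sasakian identity: xi
and g are invariant, so only the term with the Lie derivative 3 C of phi is
new. *)
Lemma cov_der_C_skew12 X Y Z : E X Y Z = - E Y X Z.
Proof.
have := congr1 (fun U => g (bracket xi U) Z) (nearly_polar X Y).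
rewrite /= !bracketDr !bracketNr !bracketZr !lie_cov_der_phi.
rewrite bracket_xi_xi derDr !killing bracket_xi_xi.
have := congr1 (g^~ Z) (nearly_polar (bracket xi X) Y).
have := congr1 (g^~ Z) (nearly_polar X (bracket xi Y)).
by rewrite /= !gE; by_points.
Qed.

Lemma cov_der_C_skew23 X Y Z : E X Y Z = - E X Z Y.
Proof. exact: cov_der_skew C_skew X Y Z. Qed.

(** * The deviation on fields orthogonal to xi *)

Lemma dev_cov_der X Y Z : eta Y = 0 -> eta Z = 0 ->
  S X Y Z = g (cov_der phi X Y) Z.
Proof. by move=> Y0 Z0; rewrite devE !gE (g_sym xi) Y0 Z0; by_points. Qed.

Lemma dev_cyc X Y Z : S Y Z X = S X Y Z.
Proof. by rewrite dev_skew23 dev_skew12 opprK. Qed.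

Lemma cov_der_C_cyc X Y Z : E Y Z X = E X Y Z.
Proof. by rewrite cov_der_C_skew23 cov_der_C_skew12 opprK. Qed.

Lemma phi_phiH X : eta X = 0 -> phi (phi X) = - X.
Proof. by move=> X0; rewrite phi_phi X0 scale0r addr0. Qed.

Lemma C_phi_phi X : C (phi (phi X)) = - C X.
Proof. by rewrite !C_phi phiN opprK (phi_phiH (eta_C X)). Qed.

Lemma dev_phiH X Y Z : eta Y = 0 -> eta Z = 0 ->
  S X (phi Y) Z = S X Y (phi Z).
Proof. by move=> Y0 Z0; move: (dev_phi X Y Z); rewrite Y0 Z0; by_points. Qed.

Lemma devNl X Y Z : S (- X) Y Z = - S X Y Z.
Proof.
by rewrite (dev_skew12 (- X)) (dev_skew23 Y) !gE -dev_skew23 -dev_skew12.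
Qed.

Lemma dev_phi1 X Y Z : eta X = 0 -> eta Y = 0 ->
  S (phi X) Y Z = S X (phi Y) Z.
Proof. by move=> X0 Y0; rewrite -2!dev_cyc dev_phiH // 2!dev_cyc. Qed.

(** The derivative of phi C + C phi = 0. *)
Lemma cov_der_C_phi X Y Z : eta Y = 0 -> eta Z = 0 ->
  E X (phi Y) Z - E X Y (phi Z) = S X Y (C Z) - S X (C Y) Z.
Proof.
move=> Y0 Z0.
have phiC : phi (C Y) + C (phi Y) = 0 by rewrite C_phi subrr.
have N0 : nabla X (phi (C Y)) + nabla X (C (phi Y)) = 0.
  by rewrite -nablaDr phiC nabla0r.
have := congr1 (g^~ Z) N0.
rewrite /= (nabla_comp _ phi_skew) (nabla_comp _ C_skew).
rewrite !gE (phi_skew (cov_der C X Y)) (C_skew (cov_der phi X Y)) C_phi gE.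
rewrite (dev_cov_der _ Y0 (eta_C Z)) (dev_cov_der _ (eta_C Y) Z0); by_points.
Qed.

(** This is d (d eta) = 0: the 2-form d eta is 2 g(A ., .), and A = - phi C -
phi expresses nabla A through dev and nabla C. *)
Lemma dev_cyclic_sum X Y Z : eta X = 0 -> eta Y = 0 -> eta Z = 0 ->
  S X (C Y) Z + S Y (C Z) X + S Z (C X) Y + 3%:R * S X Y Z =
  E X Y (phi Z) + E Y Z (phi X) + E Z X (phi Y).
Proof.
move=> X0 Y0 Z0.
have := ext2_ext1 (fun U W => gDl U W xi) X Y Z.
have : ext2 (ext1 (g^~ xi)) X Y Z = 2%:R * ext2 (fun U W => g (A U) W) X Y Z.
  by rewrite /ext2 !ext1_eta !derDr; by_points.
rewrite (ext2_skew A_skew).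
have dA U W T : eta W = 0 -> eta T = 0 -> g (cov_der A U W) T =
    - S U (C W) T + E U W (phi T) - S U W T.
  move=> W0 T0.
  rewrite (dev_cov_der _ (eta_C W) T0) (dev_cov_der _ W0 T0).
  have -> : cov_der A U W =
      - cov_der phi U (C W) - phi (cov_der C U W) - cov_der phi U W.
    rewrite [in LHS]cov_derE !AE !nablaE (nabla_comp _ phi_skew).
    rewrite [in RHS](cov_derE phi U W); apply: g_inj => Q.
    by rewrite !gE; by_points.
  by rewrite !gE phi_skew; by_points.
rewrite !dA //.
by rewrite (dev_cyc X Y Z) -(dev_cyc Z X Y); by_points.
Qed.

(** By [cov_der_C_phi], the sum of g((nabla C) ., .) with phi in one slot and
of S with C in the same slot does not depend on the slot.  So the three such
sums in [dev_cyclic_sum] can be replaced by one of them, taken three times. *)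
Lemma cov_der_C_phi_dev X Y Z : eta X = 0 -> eta Y = 0 -> eta Z = 0 ->
  3%:R * (E (phi X) Y Z + S (C X) Y Z) = 3%:R * S X Y Z +
  2%:R * (S (C X) Y Z + S X (C Y) Z + S X Y (C Z)).
Proof.
move=> X0 Y0 Z0; move: (dev_cyclic_sum X0 Y0 Z0).
move: (cov_der_C_phi X Y0 Z0) (cov_der_C_phi Y X0 Z0).
move: (cov_der_C_skew12 Y (phi X) Z) (cov_der_C_skew12 Y X (phi Z)).
move: (dev_skew12 Y X (C Z)) (dev_skew12 Y (C X) Z).
move: (dev_cyc X Y (C Z)) (dev_cyc Z (C X) Y).
by move: (cov_der_C_cyc (phi X) Y Z) (cov_der_C_cyc Z X (phi Y)); by_points.
Qed.

(** [cov_der_C_phi_dev] at phi X, using phi (phi X) = - X. *)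
Lemma cov_der_C_dev X Y Z : eta X = 0 -> eta Y = 0 -> eta Z = 0 ->
  3%:R * E X Y Z = - 3%:R * S (phi X) Y Z - S (phi (C X)) Y Z
  - 2%:R * S X (phi (C Y)) Z - 2%:R * S X Y (phi (C Z)).
Proof.
move=> X0 Y0 Z0; move: (cov_der_C_phi_dev (eta_phi X) Y0 Z0).
rewrite (phi_phiH X0) C_phi !devNl (cov_derNl C_skew) gNl.
rewrite (dev_phi1 _ X0 (eta_C Y)) (dev_phi1 (C Z) X0 Y0).
rewrite (dev_phiH _ Y0 (eta_C Z)).
by_points.
Qed.

(** All terms of [cov_der_C_dev] are skew in X and Y, except that the ones with
phi C in the first and in the second slot have different coefficients. *)
Lemma dev_phi_C X Y Z : eta X = 0 -> eta Y = 0 -> eta Z = 0 ->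
  S (phi (C X)) Y Z = S X (phi (C Y)) Z.
Proof.
move=> X0 Y0 Z0; move: (cov_der_C_dev X0 Y0 Z0) (cov_der_C_dev Y0 X0 Z0).
move: (cov_der_C_skew12 X Y Z) (dev_skew12 (phi Y) X Z) (dev_phi1 Z X0 Y0).
move: (dev_skew12 (phi (C Y)) X Z) (dev_skew12 Y (phi (C X)) Z).
by move: (dev_skew12 Y X (phi (C Z))); by_points.
Qed.

(** [dev_phi_C] at phi X.  Both phi and phi C may change slots, but the former
has to pass C on one side only, which costs a sign. *)
Lemma dev_C_opp X Y Z : eta X = 0 -> eta Y = 0 -> eta Z = 0 ->
  S (C X) Y Z = - S X (C Y) Z.
Proof.
move=> X0 Y0 Z0; move: (dev_phi_C (eta_phi X) Y0 Z0).
rewrite C_phi phiN (phi_phiH (eta_C X)) opprK (dev_phi1 _ X0 (eta_phi _)).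
rewrite (phi_phiH (eta_C Y)) (dev_skew12 X) devNl opprK.
by rewrite (dev_skew12 X) opprK.
Qed.

(** Moving C through all three slots changes the sign three times. *)
Lemma dev_C X Y Z : eta Y = 0 -> eta Z = 0 -> S (C X) Y Z = 0.
Proof.
move=> Y0 Z0.
(* X is replaced by its component orthogonal to xi, as C xi = 0. *)
have -> : C X = - C (phi (phi X)) by rewrite C_phi_phi opprK.
have := eta_phi (phi X); move: (phi (phi X)) => {}X X0; rewrite devNl.
move: (dev_C_opp X0 Y0 Z0) (dev_C_opp X0 Z0 Y0) (dev_C_opp Y0 Z0 X0).
move: (dev_skew23 (C X) Y Z) (dev_cyc X (C Y) Z) (dev_skew23 X (C Z) Y).
by move: (dev_cyc X Y (C Z)); by_points.
Qed.

Lemma cov_der_CE X Y Z : eta X = 0 -> eta Y = 0 -> eta Z = 0 ->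
  E X Y Z = - S (phi X) Y Z.
Proof.
move=> X0 Y0 Z0; move: (cov_der_C_dev X0 Y0 Z0).
have SphiC U W T : eta W = 0 -> eta T = 0 -> S (phi (C U)) W T = 0.
  by move=> W0 T0; rewrite (dev_phi1 _ (eta_C U) W0) dev_C// eta_phi.
rewrite (SphiC X) // (dev_skew12 X) (SphiC Y) // (dev_cyc (phi (C Z)) X).
by rewrite (SphiC Z) //; by_points.
Qed.

(** If C Y = 0 then (nabla_X C) Y = - C (nabla_X Y) is orthogonal to the kernel
of C, and [cov_der_CE] translates this into a statement about dev. *)
Lemma dev_kerC X Y Z : eta X = 0 -> eta Y = 0 -> eta Z = 0 ->
  C Y = 0 -> C Z = 0 -> S X Y Z = 0.
Proof.
move=> X0 Y0 Z0 CY CZ.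
have := cov_der_CE (eta_phi X) Y0 Z0.
rewrite (phi_phiH X0) devNl opprK => <-.
by rewrite cov_derE CY nabla0r add0r gNl C_skew CZ g0r !oppr0.
Qed.

(** Let k(U, W) = phi dev(U, W), which lies in the kernel of C by [dev_C].  By
[dev_kerC], k(U, W) vanishes when C W = 0, in particular k(X, k(X, Y)) = 0; but
g(k(X, k(X, Y)), Y) is - |k(X, Y)|^2. *)
Lemma dev_horizontal X Y Z : eta X = 0 -> eta Y = 0 ->
  S X Y Z = eta Z * g (C X) Y.
Proof.
move=> X0 Y0.
pose k U W := phi (dev U W).
have k_g U W T : g (k U W) T = - S U W (phi T) by rewrite phi_skew.
have Ck U W : eta U = 0 -> eta W = 0 -> C (k U W) = 0.
  move=> U0 W0; apply: g_inj => T; rewrite g0l C_skew k_g opprK.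
  by rewrite dev_cyc (dev_phi1 _ (eta_C T) U0) dev_C //; exact: eta_phi.
have k_ker U W : eta U = 0 -> eta W = 0 -> C W = 0 -> k U W = 0.
  move=> U0 W0 CW; apply: g_definite; rewrite k_g.
  rewrite dev_kerC ?oppr0 ?eta_phi//.
  by rewrite C_phi Ck// phi0 oppr0.
have k0 : k X Y = 0.
  apply: g_definite; rewrite k_g.
  have := k_g X (k X Y) Y.
  rewrite (k_ker X (k X Y) X0 (eta_phi _) (Ck _ _ X0 Y0)) g0l.
  rewrite -(dev_phiH X (eta_phi (dev X Y)) Y0).
  by move: (dev_skew23 X Y (phi (k X Y))); rewrite /k; by_points.
have := phi_phi (dev X Y); rewrite -/(k X Y) k0 phi0 => /(congr1 (g^~ Z)).
by rewrite /= !gE dev_xi (g_sym xi); by_points.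
Qed.

(** * Vanishing of C *)

(** The decomposition X = - phi (phi X) + eta(X) xi. *)
Lemma dev_split X Y Z : S X Y Z = - S (phi (phi X)) Y Z + eta X * g (C Y) Z.
Proof.
rewrite -devNl phi_phi opprD opprK -scaleNr C_dev !devE.
by rewrite (cov_derDl phi_skew) (cov_derZl phi_skew) !gE; by_points.
Qed.

(** S = eta /\ C. *)
Lemma dev_wedge X Y Z :
  S X Y Z = eta X * g (C Y) Z - eta Y * g (C X) Z + eta Z * g (C X) Y.
Proof.
rewrite dev_split (dev_skew12 _ Y) dev_split dev_horizontal ?eta_phi//.
rewrite !C_phi_phi gNl C_skew C_phi_phi gNr !gE.
by rewrite (g_sym Y); by_points.
Qed.

(** Since d Phi = 3 S = 3 eta /\ C, the identity d d Phi = 0 gives d eta /\ C =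
0 on fields orthogonal to xi, and d eta = 2 g(A ., .). *)
Lemma A_wedge_C X Y Z W : eta X = 0 -> eta Y = 0 -> eta Z = 0 -> eta W = 0 ->
  g (A X) Y * g (C Z) W - g (A X) Z * g (C Y) W + g (A X) W * g (C Y) Z
  + g (A Y) Z * g (C X) W - g (A Y) W * g (C X) Z + g (A Z) W * g (C X) Y = 0.
Proof.
move=> X0 Y0 Z0 W0.
pose s X Y Z := eta X * g (C Y) Z - eta Y * g (C X) Z + eta Z * g (C X) Y.
have ext2E U T Q : ext2 (fun X Y => g (phi X) Y) U T Q = 3%:R * s U T Q.
  rewrite (ext2_skew phi_skew) /s -dev_wedge.
  have dphiE G H K :
      g (cov_der phi G H) K = S G H K + g G H * eta K - eta H * g G K.
    by rewrite devE !gE (g_sym xi K); by_points.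
  rewrite !dphiE (dev_cyc U T Q) -(dev_cyc Q U T).
  by rewrite (g_sym Q T) (g_sym Q U) (g_sym T U); by_points.
have : ext3 (ext2 (fun X Y => g (phi X) Y)) X Y Z W = 0.
  apply: ext3_ext2 => *; first by rewrite phiD gDl.
  by rewrite phi_skew g_sym.
have -> : ext3 (ext2 (fun X Y => g (phi X) Y)) X Y Z W = 3%:R * ext3 s X Y Z W.
  have der3 U f : D U (3%:R * f) = 3%:R * D U f.
    have -> : 3%:R * f = f + f + f by ring.
    by rewrite !derDr; ring.
  by rewrite /ext3 !ext2E !der3; ring.
rewrite /s ext3_wedge //; last by move=> U T; rewrite C_skew g_sym.
by rewrite !ext1_eta; by_points.
Qed.

(* In other words, the fields span a space of dimension at least 6 at p. *)
Hypothesis large_rank : forall p (s : seq V), (size s <= 5)%N ->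
  exists2 X, forall Y, Y \in s -> ev p (g X Y) = 0 & ev p (g X X) <> 0.

(** In [A_wedge_C] at X, phi X, Z, W, with X orthogonal to Z, W, phi Z and phi
W, the values of A at Z and W reduce to values of C.  The products of two
values of C then cancel, and - |X|^2 g(C Z, W) remains. *)
Lemma C_eq0 X : C X = 0.
Proof.
suff CH Z W : eta Z = 0 -> eta W = 0 -> g (C Z) W = 0.
  apply: g_inj => Y; rewrite g0l; move: (CH _ _ (eta_phi X) (eta_phi Y)).
  by rewrite C_phi gNl phi_skew phi_phi !gE eta_C; by_points.
move=> {X} Z0 W0; apply: ev_inj => p; rewrite rmorph0.
pose s := [:: xi; Z; W; phi Z; phi W].
have [X [Xs Xn X0]] : exists X, [/\ forall Y, Y \in s -> ev p (g X Y) = 0,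
    ev p (g X X) <> 0 & eta X = 0].
  have [//|X Xs Xn] := large_rank p (s := s).
  have XE Y : ev p (g (phi (phi X)) Y) = - ev p (g X Y).
    rewrite phi_phi !gE rmorphD rmorphN rmorphM Xs ?mul0r ?addr0//.
    by rewrite !inE eqxx.
  exists (phi (phi X)); split; last exact: eta_phi.
    by move=> Y /Xs Y0; rewrite XE Y0 oppr0.
  by rewrite XE g_sym XE opprK.
have aX Y : ev p (g X (phi Y)) = 0 ->
    ev p (g (A X) Y) = ev p (g (C X) (phi Y)).
  by rewrite AE !gE !phi_skew; lra.
have aphiX Y : ev p (g X Y) = 0 -> ev p (g (A (phi X)) Y) = - ev p (g (C X) Y).
  rewrite AE C_phi phiN opprK (phi_phiH (eta_C X)) (phi_phiH X0) !gE.
  by lra.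
have cphiX Y : g (C (phi X)) Y = g (C X) (phi Y).
  by rewrite C_phi gNl phi_skew opprK.
have XphiX : g (C X) (phi X) = 0.
  by move: (cphiX X); rewrite (C_skew (phi X)) (g_sym (phi X)); by_points.
have aXX : g (A X) (phi X) = - g X X.
  rewrite AE !gE !phi_skew (phi_phiH X0) !gE.
  by move: (C_skew X X); rewrite (g_sym X (C X)); by_points.
have := congr1 (ev p) (A_wedge_C X0 (eta_phi X) Z0 W0).
rewrite !(rmorphD, rmorphN, rmorphM, rmorph0) aXX XphiX !cphiX.
rewrite !aX ?aphiX ?Xs ?inE ?eqxx ?orbT// rmorphN rmorph0 => H.
have : ev p (g X X) * ev p (g (C Z) W) = 0 by lra.
by move/eqP; rewrite mulf_eq0 => /orP[/eqP//|/eqP].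
Qed.

Theorem nearly_sasakian_sasakian X Y :
  cov_der phi X Y = g X Y *: xi - eta Y *: X.
Proof.
apply: g_inj => Z; apply/subr0_eq; rewrite -gNl -gDl -devE.
by rewrite dev_wedge !C_eq0 !g0l !mulr0 subr0 addr0.
Qed.

End NearlySasakian.
End LeviCivitaModule.

Local Open Scope classical_set_scope.
Local Open Scope ring_scope.

(** * Calculus of C^k maps *)

Section CkCalculus.
Variables (R : realType).
Implicit Types V W : normedModType R.

(** Differentials only depend on germs. *)
Lemma near_diff V W (f g : V -> W) (x : V) :
  (\near x, f x = g x) -> differentiable f x ->
  differentiable g x /\ 'd g x = 'd f x :> (V -> W).
Proof.
move=> fg df.
have [dfc /eqaddoP dfo] := (diff_locallyP x f).1 df.
have go : g \o shift x = cst (g x) + 'd f x +o_ 0 id.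
  apply/eqaddoP => e e0; have := dfo e e0.
  have fg0 : \forall h \near 0, f (h + x) = g (h + x).
    move: fg; rewrite (near_shift 0 x); apply: filterS => h /=.
    by rewrite subr0.
  apply: filterS2 fg0 => h fgh /=.
  by rewrite /= !fctE /= fgh (nbhs_singleton fg).
have dE := diff_unique dfc go.
split; last exact: dE.
by apply/(diff_locallyP x g); rewrite dE; split.
Unshelve. all: by end_near. Qed.

Lemma Ck_on_local V W (U : set V) k (f : V -> W) :
  (forall x, U x -> exists2 O : set V, O x & Ck_on O k f) -> Ck_on U k f.
Proof.
elim: k f => [|k IH] f /= Uf; first by move=> x /Uf[B Bx]; apply.
split=> [x /Uf[B Bx [fd _]]|v]; first exact: fd.
by apply: IH => x /Uf[B Bx [_ fk]]; exists B.
Qed.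

Lemma Ck_on_eq V W (U : set V) k (f g : V -> W) : open U ->
  (forall x, U x -> f x = g x) -> Ck_on U k f -> Ck_on U k g.
Proof.
move=> oU; elim: k f g => [|k IH] f g fg /=.
  move=> fC x Ux; have nfg : \near x, f x = g x.
    by near do apply: fg; exact: open_nbhs_nbhs.
  rewrite /prop_for /continuous_at -(fg x Ux).
  apply: cvg_trans (fC x Ux); apply: near_eq_cvg.
  by apply: filterS nfg.
move=> [fd fk]; split=> [x Ux|v].
  have nfg : \near x, f x = g x by near do apply: fg; exact: open_nbhs_nbhs.
  exact: (near_diff nfg (fd x Ux)).1.
apply: IH (fk v) => x Ux; apply: near_eq_derive.
by near do apply: fg; exact: open_nbhs_nbhs.
Unshelve. all: by end_near. Qed.

Lemma Ck_onW V W (U : set V) k (f : V -> W) : Ck_on U k.+1 f -> Ck_on U k f.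
Proof.
elim: k f => [|k IH] f /=.
  by move=> [fd _] x Ux; apply: differentiable_continuous; exact: fd.
by move=> [fd fk]; split=> // v; apply: IH; exact: fk.
Qed.

Lemma Ck_on_cst V W (U : set V) k (c : W) : Ck_on U k (fun _ : V => c).
Proof.
elim: k c => [|k IH] c /=; first by move=> x _; exact: cst_continuous.
split=> [x _|v]; first exact: differentiable_cst.
rewrite (_ : 'D_v _ = fun=> 0); first exact: IH.
by apply/funext => x; rewrite derive_cst.
Qed.

Lemma Ck_onD V W (U : set V) k (f f' : V -> W) : open U ->
  Ck_on U k f -> Ck_on U k f' -> Ck_on U k (fun x => f x + f' x).
Proof.
move=> oU; elim: k f f' => [|k IH] f f' /=.
  by move=> fC f'C x Ux; apply: continuousD; [exact: fC|exact: f'C].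
move=> [fd fk] [f'd f'k]; split=> [x Ux|v].
  by apply: differentiableD; [exact: fd|exact: f'd].
apply: (@Ck_on_eq _ _ _ _ (fun x => 'D_v f x + 'D_v f' x)) => //.
  move=> x Ux; rewrite -deriveD //; apply: diff_derivable; [exact: fd|].
  exact: f'd.
by apply: IH; [exact: fk|exact: f'k].
Qed.

Lemma Ck_on_sum V W (U : set V) k n (f : 'I_n -> V -> W) : open U ->
  (forall i, Ck_on U k (f i)) -> Ck_on U k (fun x => \sum_i f i x).
Proof.
move=> oU fk.
elim: n f fk => [|n IH] f fk.
  rewrite (_ : (fun x => _) = fun=> 0); first exact: Ck_on_cst.
  by apply/funext => x; rewrite big_ord0.
rewrite (_ : (fun x => _) = fun x => \sum_(i < n) f (widen_ord (leqnSn n) i) x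
   + f ord_max x).
  by apply: Ck_onD => //; apply: IH => i; exact: fk.
by apply/funext => x; rewrite big_ord_recr.
Qed.

Lemma Ck_onM V (U : set V) k (f f' : V -> R) : open U ->
  Ck_on U k f -> Ck_on U k f' -> Ck_on U k (fun x => f x * f' x).
Proof.
move=> oU; elim: k f f' => [|k IH] f f'.
  by move=> fC f'C x Ux; apply: continuousM; [exact: fC|exact: f'C].
move=> fS f'S; have [fd fk] := fS; have [f'd f'k] := f'S.
split=> [x Ux|v].
  by apply: differentiableM; [exact: fd|exact: f'd].
apply: (@Ck_on_eq _ _ _ _ (fun x => f x * 'D_v f' x + f' x * 'D_v f x)) => //.
  move=> x Ux; rewrite -[RHS]/('D_v (f * f') x) deriveM //.
    by apply: diff_derivable; exact: fd.
  by apply: diff_derivable; exact: f'd.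
apply: Ck_onD => //; apply: IH; [exact: Ck_onW|exact: f'k|exact: Ck_onW|].
exact: fk.
Qed.

Lemma Ck_on_prod V (U : set V) k n (f : 'I_n -> V -> R) : open U ->
  (forall i, Ck_on U k (f i)) -> Ck_on U k (fun x => \prod_i f i x).
Proof.
move=> oU fk.
elim: n f fk => [|n IH] f fk.
  rewrite (_ : (fun x => _) = fun=> 1); first exact: Ck_on_cst.
  by apply/funext => x; rewrite big_ord0.
rewrite (_ : (fun x => _) = fun x =>
    (\prod_(i < n) f (widen_ord (leqnSn n) i) x) * f ord_max x).
  by apply: Ck_onM => //; apply: IH => i; exact: fk.
by apply/funext => x; rewrite big_ord_recr.
Qed.

Lemma Ck_on_linear_comp V W W' (U : set V) k (l : {linear W -> W'})
    (f : V -> W) : open U -> continuous l ->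
  Ck_on U k f -> Ck_on U k (l \o f).
Proof.
move=> oU lC; elim: k f => [|k IH] f /=.
  by move=> fC x Ux; apply: continuous_comp; [exact: fC|exact: lC].
have ld y : differentiable l y by exact: linear_differentiable.
move=> [fd fk]; split=> [x Ux|v].
  by apply: differentiable_comp; [exact: fd|exact: ld].
apply: (@Ck_on_eq _ _ _ _ (l \o 'D_v f)) => //; last exact/IH/fk.
move=> x Ux; have fx := fd x Ux.
rewrite deriveE; last exact: differentiable_comp.
by rewrite diff_comp //= diff_lin // -deriveE.
Qed.

End CkCalculus.

Lemma Ck_on_id (R : realType) (V : normedModType R) (U : set V) k :
  Ck_on U k (@idfun V).
Proof.
case: k => [|k]; first by move=> x _; exact: cvg_id.
split=> [x _|v].
  by apply: (@linear_differentiable _ _ _ idfun) => y; exact: cvg_id.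
rewrite (_ : 'D_v _ = fun=> v); first exact: Ck_on_cst.
by apply/funext => x; exact: derive_id.
Qed.

Lemma diff_coord (R : realType) m i (a v : 'rV[R]_m) :
  'd (fun N : 'rV[R]_m => N 0 i : R) a v = v 0 i.
Proof.
have coord_linear : linear (fun N : 'rV[R]_m => N 0 i : R).
  by move=> k u w; rewrite !mxE.
pose L := GRing.isLinear.Build _ _ _ _ _ coord_linear.
pose l : {linear 'rV[R]_m -> R} := HB.pack (fun N : 'rV[R]_m => N 0 i) L.
exact: (congr1 (fun f : 'rV[R]_m -> R => f v)
  (@diff_lin _ _ _ l a (@coord_continuous _ _ _ _ _))).
Qed.

Lemma linear_sumZ (R : pzRingType) (U W : lmodType R) (l : {linear U -> W})
    n (a : 'I_n -> R) (w : 'I_n -> U) :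
  l (\sum_i a i *: w i) = \sum_i a i *: l (w i).
Proof. by rewrite linear_sum; apply: eq_bigr => i _; rewrite linearZ. Qed.

Lemma linear_row_sum (R : pzRingType) m (W : lmodType R)
    (l : {linear 'rV[R]_m -> W}) v :
  l v = \sum_i v 0 i *: l (delta_mx 0 i).
Proof. by rewrite {1}[v]row_sum_delta linear_sumZ. Qed.

Section CkCoordinates.
Variables (R : realType) (V : normedModType R) (U : set V).
Hypothesis oU : open U.

Lemma Ck_on_coord k m (f : V -> 'rV[R]_m) i :
  Ck_on U k f -> Ck_on U k (fun x => f x 0 i).
Proof.
have coord_linear : linear (fun N : 'rV[R]_m => N 0 i).
  by move=> a u v; rewrite !mxE.
pose L := GRing.isLinear.Build _ _ _ _ _ coord_linear.
pose l : {linear 'rV[R]_m -> R} := HB.pack (fun N : 'rV[R]_m => N 0 i) L.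
exact: (@Ck_on_linear_comp _ _ _ _ U k l f oU (@coord_continuous _ _ _ _ _)).
Qed.

Lemma Ck_onZ (W : normedModType R) k (f : V -> R) (w : W) :
  Ck_on U k f -> Ck_on U k (fun x => f x *: w).
Proof.
have scale_linear : linear (fun a : R => a *: w).
  by move=> a u v; rewrite scalerDl scalerA.
pose L := GRing.isLinear.Build _ _ _ _ _ scale_linear.
pose l : {linear R -> W} := HB.pack (fun a : R => a *: w) L.
exact: (@Ck_on_linear_comp _ _ _ _ U k l f oU (@scalel_continuous _ _ w)).
Qed.

Lemma Ck_on_row k m (f : V -> 'rV[R]_m) :
  (forall i, Ck_on U k (fun x => f x 0 i)) -> Ck_on U k f.
Proof.
move=> fk; rewrite (_ : f = fun x => \sum_i f x 0 i *: delta_mx 0 i).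
  by apply: Ck_on_sum => // i; exact: Ck_onZ.
by apply/funext => x; rewrite [LHS]row_sum_delta.
Qed.

(** A directional derivative of the composite is a sum of products of partial
derivatives of F, composed with f, and of derivatives of coordinates of f; hence
the induction on k. *)
Lemma Ck_on_comp k m (U' : set 'rV[R]_m) (F : 'rV[R]_m -> R)
    (f : V -> 'rV[R]_m) : (forall x, U x -> U' (f x)) ->
  Ck_on U' k F -> Ck_on U k f -> Ck_on U k (F \o f).
Proof.
move=> UU'; elim: k F => [|k IH] F.
  by move=> FC fC x Ux; apply: continuous_comp; [exact: fC|exact/FC/UU'].
move=> [Fd Fk] fS; have [fd fk] := fS; split=> [x Ux|v].
  by apply: differentiable_comp; [exact: fd|exact/Fd/UU'].
apply: (@Ck_on_eq _ _ _ _ _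
  (fun x => \sum_i ('D_v f x) 0 i * 'D_(delta_mx 0 i) F (f x))) => //.
  move=> x Ux; have fx := fd x Ux; have Fx := Fd _ (UU' _ Ux).
  rewrite (deriveE v (differentiable_comp fx Fx)) (deriveE v fx).
  have -> : 'd (F \o f) x v = 'd F (f x) ('d f x v) by rewrite diff_comp.
  rewrite [RHS]linear_row_sum.
  by apply: eq_bigr => i _; rewrite deriveE.
apply: Ck_on_sum => // i; apply: Ck_onM => //.
  exact/Ck_on_coord/fk.
by apply: (IH ('D_(delta_mx 0 i) F)); [exact: Fk|exact: Ck_onW].
Qed.

End CkCoordinates.

(** * Bump functions *)

Section Bump.
Variable R : realType.

(** The functions t^(- j) exp(- 1 / t), extended by 0 to t <= 0.  All j are
considered together because the derivative of flat j is a combination of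
flat (j + 1) and flat (j + 2). *)
Definition flat (j : nat) (t : R) : R :=
  if 0 < t then t^-1 ^+ j * expR (- t^-1) else 0.

Lemma flat_le0 j t : t <= 0 -> flat j t = 0.
Proof. by rewrite /flat ltNge => ->. Qed.

Lemma flat_gt0 j t : 0 < t -> 0 < flat j t.
Proof.
by move=> t0; rewrite /flat t0 mulr_gt0 ?expR_gt0// exprn_gt0 ?invr_gt0.
Qed.

(** From exp s >= s^(j + 2) / (j + 2)! with s = 1 / t.  The difference quotient
of flat j at 0 is flat (j + 1), so this bound gives its derivative there. *)
Lemma flat_bound j t : `|flat j.+1 t| <= j.+2`!%:R * `|t|.
Proof.
have [t0|t0] := ltP 0 t; last by rewrite flat_le0// normr0 mulr_ge0.
rewrite !gtr0_norm ?flat_gt0// /flat t0.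
have s0 : 0 < t^-1 by rewrite invr_gt0.
rewrite -[X in _ <= _ * X]invrK; move: (t^-1) s0 => s s0.
rewrite expRN ler_pdivrMr ?expR_gt0// mulrAC ler_pdivlMr // -exprSr.
rewrite mulrC -ler_pdivrMr ?ltr0n ?fact_gt0//.
by apply: le_trans (expR_ge1Dxn j.+1 (ltW s0)); rewrite lerDr.
Qed.

Lemma is_derive_flat j (t : R) :
  is_derive t 1 (flat j) (flat j.+2 t - j%:R * flat j.+1 t).
Proof.
have [t0|t0|t0] := ltgtP t 0.
- rewrite !flat_le0 ?ltW// mulr0 subr0.
  apply: (@near_eq_is_derive _ _ _ (cst 0)).
  near=> x; rewrite /cst flat_le0//.
  near: x; exact: lt_le_nbhsl.
- pose H := ((id ^+ j) * (expR \o -%R) : R -> R) \o GRing.inv.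
  apply: (@near_eq_is_derive _ _ _ H).
    near=> x.
    have x0 : 0 < x by near: x; exact: lt_nbhsr.
    by rewrite /H /flat x0 /= !fctE /=.
  have tn0 : t != 0 by rewrite gt_eqF.
  have dinv : is_derive t 1 GRing.inv (- t ^- 2 *: 1 : R).
    apply: DeriveDef; first by apply: (@derivableV _ _ id).
    by rewrite (@deriveV _ _ id)// derive_id.
  apply: (@is_derive_eq _ _ _ _ _ _ _ _ (is_derive1_comp _ dinv)).
  rewrite /flat t0 /= fctE /= -exprVn /GRing.scale /=.
  move: (t^-1) (expR _) => s e.
  by case: j {H} => [|j]; rewrite -?natr1 /= !exprS; ring.
- rewrite t0 !flat_le0// mulr0 subr0.
  have : (fun h : R => h^-1 *: ((flat j \o shift 0) (h *: 1) - flat j 0)) @ 0^'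
      --> (0 : R).
    apply/cvgr0Pnorm_le => e e0; near=> h.
    have hn0 : h != 0 by near: h; exact: nbhs_dnbhs_neq.
    rewrite /= addr0 [h *: 1]mulr1 (flat_le0 j (lexx 0)) subr0.
    have -> : h^-1 *: flat j h = flat j.+1 h.
      by rewrite /flat; case: ifP => _; rewrite ?scaler0// exprS -mulrA.
    apply: le_trans (flat_bound j h) _.
    rewrite -ler_pdivlMl ?ltr0n ?fact_gt0//.
    near: h; apply: dnbhs0_le.
    by rewrite mulr_gt0// invr_gt0 ltr0n fact_gt0.
  move=> cv; apply: DeriveDef; first by apply/cvg_ex; exists 0.
  exact: cvg_lim cv.
Unshelve. all: by end_near. Qed.

Lemma Ck_on_flat (V : normedModType R) (U : set V) k j (f : V -> R) : open U ->
  Ck_on U k f -> Ck_on U k (flat j \o f).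
Proof.
move=> oU; have flatd i t : differentiable (flat i) t.
  by apply/derivable1_diffP; case: (is_derive_flat i t).
elim: k j => [|k IH] j.
  move=> fC x Ux; apply: continuous_comp; first exact: fC.
  exact: differentiable_continuous.
move=> fS; have [fd fk] := fS; split=> [x Ux|v].
  by apply: differentiable_comp; [exact: fd|exact: flatd].
apply: (@Ck_on_eq _ _ _ _ _ (fun x => 'D_v f x *
  ((flat j.+2 \o f) x + (- j%:R) * (flat j.+1 \o f) x))) => //.
  move=> x Ux; have fx := fd x Ux; have Fx := flatd j (f x).
  rewrite (deriveE v (differentiable_comp fx Fx)) (deriveE v fx).
  apply/esym; apply: (etrans (congr1 (@^~ v) (diff_comp fx Fx))).
  have [dF dE] := is_derive_flat j (f x).
  by rewrite [LHS]/comp deriv1E// derive1E dE mulNr.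
apply: Ck_onM => //; first exact: fk.
apply: Ck_onD => //; first exact/IH/Ck_onW.
by apply: Ck_onM => //; [exact: Ck_on_cst|exact/IH/Ck_onW].
Qed.

Variables (m : nat) (a : 'rV[R]_m) (r : R).
Hypothesis r0 : 0 < r.

(** A product over the coordinates, because the norm of row vectors is the
supremum norm. *)
Definition bump_fun (x : 'rV[R]_m) : R :=
  \prod_i (flat 0 (r + (x 0 i - a 0 i)) * flat 0 (r - (x 0 i - a 0 i))).

Lemma bump_center : 0 < bump_fun a.
Proof.
rewrite /bump_fun; apply: prodr_gt0 => i _.
by rewrite subrr addr0 subr0 mulr_gt0 ?flat_gt0.
Qed.

Lemma bump_out x : r <= `|x - a| -> bump_fun x = 0.
Proof.
move=> rx; apply/eqP; rewrite /bump_fun prodf_seq_eq0; apply/hasP.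
have [i ri] : exists i, r <= `|x 0 i - a 0 i|.
  have /mx_norm_neq0[[i0 i]] : mx_norm (x - a) != 0.
    by rewrite gt_eqF// (lt_le_trans r0).
  rewrite ord1 => nE; exists i; move: rx.
  by rewrite -[`|x - a|]/(mx_norm (x - a)) nE !mxE.
exists i; first exact: mem_index_enum.
rewrite /= mulf_eq0; have [h|h] := leP 0 (x 0 i - a 0 i).
  rewrite ger0_norm// in ri.
  by rewrite (@flat_le0 0 (r - _)) ?eqxx ?orbT ?subr_le0.
rewrite ltr0_norm// in ri; rewrite flat_le0 ?eqxx//.
by rewrite -lerBrDr sub0r.
Qed.

Lemma Ck_on_bump k : Ck_on setT k bump_fun.
Proof.
have oT : open [set: 'rV[R]_m] by exact: openT.
have xk i : Ck_on setT k (fun x : 'rV[R]_m => x 0 i).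
  exact: (@Ck_on_coord _ _ _ oT k m idfun i (@Ck_on_id _ _ _ k)).
have dk (c : R) i : Ck_on setT k (fun x : 'rV[R]_m => r + c * (x 0 i - a 0 i)).
  apply: Ck_onD => //; first exact: Ck_on_cst.
  apply: Ck_onM => //; first exact: Ck_on_cst.
  by apply: Ck_onD => //; exact: Ck_on_cst.
apply: Ck_on_prod => // i; apply: Ck_onM => //; apply: Ck_on_flat => //.
  rewrite (_ : (fun x => _) = fun x : 'rV[R]_m => r + 1 * (x 0 i - a 0 i)) //.
  by apply/funext => x; rewrite mul1r.
rewrite (_ : (fun x => _) = fun x : 'rV[R]_m => r + -1 * (x 0 i - a 0 i)) //.
by apply/funext => x; rewrite mulN1r.
Qed.

End Bump.

(** * Changes of charts *)

Section Charts.
Variables (R : realType) (m : nat) (M : manifold R m).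
Implicit Types (c : chart R m M) (p : M).

Lemma cinv_dom c x : (c @` cdom c) x -> cdom c (cinv c x).
Proof. by move=> [p cp <-]; rewrite cmapK. Qed.

Lemma cinvK c x : (c @` cdom c) x -> c (cinv c x) = x.
Proof. by move=> [p cp <-]; rewrite cmapK. Qed.

Lemma open_overlap c c' : open (c @` (cdom c `&` cdom c')).
Proof.
rewrite openE => x [p [cp c'p] cpx].
have cx : (c @` cdom c) x by exists p.
have near_c : \near x, (c @` cdom c) x.
  by apply: open_nbhs_nbhs; split=> //; exact: cimg_open.
have near_c' : \near x, cdom c' (cinv c x).
  apply: (cinv_continuous cx); apply: open_nbhs_nbhs; split.
    exact: cdom_open.
  by rewrite -cpx cmapK.
apply: filterS2 near_c near_c' => y cy c'y.
by exists (cinv c y); [split=> //; exact: cinv_dom|exact: cinvK].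
Qed.

Lemma overlap_near c c' p : cdom c p -> cdom c' p ->
  \forall y \near c p, (c @` (cdom c `&` cdom c')) y.
Proof.
by move=> cp c'p; apply: open_nbhs_nbhs; split; [exact: open_overlap|exists p].
Qed.

Lemma diff_transition c c' p : atlas c -> atlas c' -> cdom c p -> cdom c' p ->
  differentiable (c' \o cinv c) (c p).
Proof.
move=> ac ac' cp c'p.
by have [td _] := atlas_smooth ac ac' 1%N; apply: td; exists p.
Qed.

(** The chain rule; components and derivatives along fields, defined through the
preferred charts, can thereby be computed in any chart. *)
Lemma diff_chart_change (W : normedModType R) (F : M -> W) c c' p :
  atlas c -> atlas c' -> cdom c p -> cdom c' p ->
  differentiable (F \o cinv c') (c' p) ->
  forall v, 'd (F \o cinv c) (c p) v =
            'd (F \o cinv c') (c' p) ('d (c' \o cinv c) (c p) v).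
Proof.
move=> ac ac' cp c'p Fd v.
have td := diff_transition ac ac' cp c'p.
have FE : \forall y \near c p,
      ((F \o cinv c') \o (c' \o cinv c)) y = (F \o cinv c) y.
  apply: filterS (overlap_near cp c'p) => _ [q [cq c'q] <-] /=.
  by rewrite (cmapK cq) cmapK.
have Fd' : differentiable (F \o cinv c') ((c' \o cinv c) (c p)).
  by rewrite /= cmapK.
have [_ dE] := near_diff FE (differentiable_comp td Fd').
apply: (etrans (congr1 (@^~ v) dE)).
apply: (etrans (congr1 (@^~ v) (diff_comp td Fd'))).
by rewrite [(c' \o cinv c) (c p)]/comp (cmapK cp).
Qed.

Lemma diff_chart_id c p v : cdom c p -> 'd (c \o cinv c) (c p) v = v.
Proof.
move=> cp.
have idE : \forall y \near c p, idfun y = (c \o cinv c) y.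
  by apply: filterS (overlap_near cp cp) => _ [q [cq _] <-] /=; rewrite cmapK.
have idC : continuous (@idfun 'rV[R]_m) by move=> y; exact: cvg_id.
have [_ dE] := near_diff idE (linear_differentiable (c p) idC).
apply: (etrans (congr1 (@^~ v) dE)).
exact: (congr1 (@^~ v) (diff_lin (c p) idC)).
Qed.

Lemma componentsK c p : atlas c -> cdom c p ->
  cancel (components c p) (of_components c p).
Proof.
move=> ac cp v; have a0 := chart_at_atlas p; have d0 := chart_at_dom p.
rewrite /components /of_components -(diff_chart_change a0 ac d0 cp).
  exact: diff_chart_id.
exact: diff_transition.
Qed.

Lemma components_of c c' p e : atlas c -> atlas c' -> cdom c p -> cdom c' p ->
  components c' p (of_components c p e) = 'd (c' \o cinv c) (c p) e.
Proof.
move=> ac ac' cp c'p; have a0 := chart_at_atlas p; have d0 := chart_at_dom p.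
have td := diff_transition a0 ac' d0 c'p.
exact: (esym (diff_chart_change ac a0 cp d0 td e)).
Qed.

Lemma of_components_chart_at p v : of_components (chart_at p) p v = v.
Proof. exact: diff_chart_id (chart_at_dom p). Qed.

Lemma components0 c p : components c p 0 = 0.
Proof. exact: linear0. Qed.

Lemma of_components0 c p : of_components c p 0 = 0.
Proof. exact: linear0. Qed.

Lemma dirder_chart (X : M -> 'rV[R]_m) f c p : atlas c -> cdom c p ->
  smooth_fun f ->
  dirder X f p = 'd (f \o cinv c : _ -> R) (c p) (components c p (X p)).
Proof.
move=> ac cp fS; rewrite /dirder /components.
have [fd _] := fS c ac 1%N; have fdp := fd (c p) (ex_intro2 _ _ p cp erefl).
exact: (diff_chart_change (chart_at_atlas p) ac (chart_at_dom p) cp fdp).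
Qed.

(** * Smooth functions and vector fields *)

Lemma smooth_fun_cst (a : R) : smooth_fun (fun _ : M => a).
Proof. by move=> c _ k; exact: Ck_on_cst. Qed.

Lemma smooth_funD f f' : smooth_fun f -> smooth_fun f' ->
  smooth_fun (fun p : M => f p + f' p).
Proof.
move=> fS f'S c ac k; apply: (@Ck_onD _ _ _ _ _ (f \o cinv c) (f' \o cinv c)).
- exact: cimg_open.
- exact: fS.
- exact: f'S.
Qed.

Lemma smooth_funM f f' : smooth_fun f -> smooth_fun f' ->
  smooth_fun (fun p : M => f p * f' p).
Proof.
move=> fS f'S c ac k; apply: (@Ck_onM _ _ _ _ (f \o cinv c) (f' \o cinv c)).
- exact: cimg_open.
- exact: fS.
- exact: f'S.
Qed.

Definition coords (X : M -> 'rV[R]_m) c i : 'rV[R]_m -> R :=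
  fun x => components c (cinv c x) (X (cinv c x)) 0 i.

Lemma smooth_coords X c i : atlas c -> smooth_vfield X ->
  smooth_on (c @` cdom c) (coords X c i).
Proof.
move=> ac XS k; have := XS c ac k.
by move=> /(Ck_on_coord (@cimg_open _ _ _ c) i).
Qed.

Lemma smooth_coordsP X : (forall c i, atlas c ->
  smooth_on (c @` cdom c) (coords X c i)) -> smooth_vfield X.
Proof.
move=> XS c ac k; apply: Ck_on_row; first exact: cimg_open.
by move=> i; exact: XS.
Qed.

Lemma vfield_coords X c p : atlas c -> cdom c p ->
  X p = \sum_i coords X c i (c p) *: of_components c p (delta_mx 0 i).
Proof.
move=> ac cp; rewrite -[LHS](componentsK ac cp).
rewrite [LHS](linear_row_sum ('d (chart_at p \o cinv c) (c p))).
by apply: eq_bigr => i _; rewrite /coords cmapK.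
Qed.

Lemma smooth_vfieldD X Y : smooth_vfield X -> smooth_vfield Y ->
  smooth_vfield (fun p : M => X p + Y p).
Proof.
move=> XS YS; apply: smooth_coordsP => c i ac k.
rewrite (_ : coords _ c i = fun x => coords X c i x + coords Y c i x).
  by apply: Ck_onD;
    [exact: cimg_open|exact: smooth_coords|exact: smooth_coords].
by apply/funext => x; rewrite /coords /components linearD mxE.
Qed.

Lemma smooth_vfieldZ f X : smooth_fun f -> smooth_vfield X ->
  smooth_vfield (fun p : M => f p *: X p).
Proof.
move=> fS XS; apply: smooth_coordsP => c i ac k.
rewrite (_ : coords _ c i = fun x => (f \o cinv c) x * coords X c i x).
  by apply: Ck_onM; [exact: cimg_open|exact: fS|exact: smooth_coords].
by apply/funext => x; rewrite /coords /components linearZ mxE.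
Qed.

Lemma smooth_vfield0 : smooth_vfield (fun _ : M => 0).
Proof.
apply: smooth_coordsP => c i ac k.
rewrite (_ : coords _ c i = fun=> 0); first exact: Ck_on_cst.
by apply/funext => x; rewrite /coords components0 mxE.
Qed.

Lemma smooth_dirder (X : M -> 'rV[R]_m) (f : M -> R) :
  smooth_vfield X -> smooth_fun f ->
  smooth_fun (dirder X f).
Proof.
move=> XS fS c ac k; have oc := @cimg_open _ _ _ c.
pose F := f \o cinv c; have Fk := fS c ac k.+1.
apply: (@Ck_on_eq _ _ _ _ _ (fun x => \sum_i coords X c i x *
  'D_(delta_mx 0 i) F x)) => //.
  move=> x cx /=; have cp := cinv_dom cx.
  rewrite (dirder_chart _ ac cp fS) (cinvK cx).
  rewrite [RHS](linear_row_sum ('d F x)); apply: eq_bigr => i _.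
  by rewrite deriveE //; exact: Fk.1.
apply: Ck_on_sum => // i; apply: Ck_onM => //; first exact: smooth_coords.
exact: Fk.2.
Qed.

Lemma smooth_metric (g : M -> 'rV[R]_m -> 'rV[R]_m -> R) X Y :
  riemannian_metric g ->
  smooth_vfield X -> smooth_vfield Y ->
  smooth_fun (fun p : M => g p (X p) (Y p)).
Proof.
move=> gm XS YS c ac k; have oc := @cimg_open _ _ _ c.
have glin p v : linear_for *%R (g p v) by apply: metric_linear.
have gsum p v (a : 'I_m -> R) (w : 'I_m -> 'rV[R]_m) :
    g p v (\sum_i a i *: w i) = \sum_i a i * g p v (w i).
  pose L := GRing.isLinear.Build _ _ _ _ _ (glin p v).
  pose l : {scalar 'rV[R]_m} := HB.pack (g p v) L.
  rewrite -[LHS]/(l _) linear_sum; apply: eq_bigr => i _.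
  by rewrite linearZ.
apply: (@Ck_on_eq _ _ _ _ _ (fun x => \sum_i \sum_j coords X c i x *
  (coords Y c j x * ((fun p => g p (of_components c p (delta_mx 0 i))
     (of_components c p (delta_mx 0 j))) \o cinv c) x))) => //.
  move=> x cx /=; have cp := cinv_dom cx.
  rewrite [in RHS](vfield_coords X ac cp) (Defs.metric_sym gm) gsum (cinvK cx).
  apply: eq_bigr => i _; rewrite (Defs.metric_sym gm).
  by rewrite (vfield_coords Y ac cp) gsum (cinvK cx) mulr_sumr.
apply: Ck_on_sum => // i; apply: Ck_on_sum => // j.
apply: Ck_onM => //; first exact: smooth_coords.
apply: Ck_onM => //; first exact: smooth_coords.
exact: (metric_smooth gm).
Qed.

Lemma smooth_endo_vfield
    (phi : M -> {linear 'rV[R]_m -> 'rV[R]_m}) (X : M -> 'rV[R]_m) :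
  smooth_endo phi -> smooth_vfield X ->
  smooth_vfield (fun p : M => phi p (X p)).
Proof.
move=> phiS XS; apply: smooth_coordsP => c j ac k.
have oc := @cimg_open _ _ _ c.
apply: (@Ck_on_eq _ _ _ _ _ (fun x => \sum_i coords X c i x *
  ((fun p => components c p (phi p (of_components c p (delta_mx 0 i)))) \o
    cinv c) x 0 j)) => //.
  move=> x cx; have cp := cinv_dom cx.
  rewrite [RHS]/coords /comp; have := vfield_coords X ac cp.
  rewrite (cinvK cx); move: (cinv c x) cp => p cp ->.
  rewrite (linear_sumZ (phi p)) [in RHS]/components.
  rewrite (linear_sumZ ('d (c \o cinv (chart_at p)) (chart_at p p))) summxE.
  by apply: eq_bigr => i _; rewrite [RHS]mxE.
apply: Ck_on_sum => // i; apply: Ck_onM => //; first exact: smooth_coords.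
by apply: Ck_on_coord => //; exact: phiS.
Qed.

End Charts.

(** * Extension from a chart by zero *)

Section Extension.
Variables (R : realType) (m : nat) (M : manifold R m).
Variables (c : chart R m M) (ac : atlas c) (p : M).

Lemma chart_ball : cdom c p -> exists2 r : R, 0 < r &
  [set y | `|y - c p| <= r] `<=` c @` cdom c.
Proof.
move=> cp; have : nbhs (c p) (c @` cdom c).
  by apply: open_nbhs_nbhs; split; [exact: cimg_open|exists p].
move=> /nbhs_ballP[e /= e0 ballc]; exists (e / 2); first by rewrite divr_gt0.
move=> y /= ye; apply: ballc; rewrite -ball_normE /= distrC.
by apply: (le_lt_trans ye); rewrite ltr_pdivrMr// ltr_pMr// ltr1n.
Qed.

Variables (r : R) (r0 : 0 < r).
Hypothesis ball_img : [set y | `|y - c p| <= r] `<=` c @` cdom c.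

Let K : set M := cinv c @` [set y | `|y - c p| <= r].

(** K is compact, and M is a Hausdorff space. *)
Let K_closed : closed K.
Proof.
apply: compact_closed; first exact: manifold_hausdorff.
apply: continuous_compact.
  apply: continuous_in_subspaceT => x /set_mem xr.
  by apply: cinv_continuous; exact: ball_img.
have -> : [set y | `|y - c p| <= r] = closed_ball (c p) r.
  rewrite closed_ballE//; apply/seteqP.
  by split => y; rewrite /closed_ball_ /= distrC.
apply: bounded_closed_compact; last exact: closed_ball_closed.
exists (r + `|c p|); split; first exact: num_real.
move=> x xr y; rewrite closed_ballE// /closed_ball_ /= distrC => yr.
rewrite (le_trans _ (ltW xr))// -[in leLHS](subrK (c p) y).
by rewrite (le_trans (ler_normD _ _))// lerD2r.
Qed.

Section Supported.
Variable H : 'rV[R]_m -> R.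
Hypothesis Hk : forall k, Ck_on setT k H.
Hypothesis H_out : forall y, r <= `|y - c p| -> H y = 0.

Definition extend_fun (q : M) : R := if `[< cdom c q >] then H (c q) else 0.

Definition extend_vfield (e : 'rV[R]_m) (q : M) : 'rV[R]_m :=
  if `[< cdom c q >] then of_components c q (H (c q) *: e) else 0.

(** Smoothness of a map extended by zero is to be checked on the chart only:
away from it the map vanishes near each point, as K is closed and H is
supported in its image. *)
Lemma chart_cases (W : normedModType R) c' k (f : 'rV[R]_m -> W) :
  atlas c' ->
  Ck_on (c' @` (cdom c' `&` cdom c)) k f ->
  (forall x, (c' @` cdom c') x -> (cdom c (cinv c' x) -> H (c (cinv c' x)) = 0)
    -> f x = 0) ->
  Ck_on (c' @` cdom c') k f.
Proof.
move=> ac' f_in f_out; apply: Ck_on_local => x c'x.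
have [cx|ncx] := pselect (cdom c (cinv c' x)).
  exists (c' @` (cdom c' `&` cdom c)) => //.
  by exists (cinv c' x); [split=> //; exact: cinv_dom|exact: cinvK].
pose B := (c' @` cdom c') `&` (cinv c' @^-1` (~` K)).
have oB : open B.
  rewrite openE => y [c'y nKy].
  apply: filterI.
    by apply: open_nbhs_nbhs; split=> //; exact: cimg_open.
  apply: (cinv_continuous c'y); apply: open_nbhs_nbhs; split=> //.
  exact: (closed_openC K_closed).
exists B.
  split=> // -[y yr yx]; apply: ncx; rewrite /= -yx.
  exact/cinv_dom/ball_img.
apply: (@Ck_on_eq _ _ _ _ _ (fun=> 0)) => //; last exact: Ck_on_cst.
move=> y [c'y nKy]; apply/esym; apply: f_out => // cy.
apply: H_out; rewrite leNgt; apply/negP => yr; apply: nKy.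
by exists (c (cinv c' y)); [exact: ltW|rewrite cmapK].
Qed.

Lemma smooth_extend_fun : smooth_fun extend_fun.
Proof.
move=> c' ac' k; apply: chart_cases => //; last first.
  by move=> x c'x Hx; rewrite /= /extend_fun; case: asboolP.
apply: (@Ck_on_eq _ _ _ _ _ (H \o (c \o cinv c'))) => //.
- exact: open_overlap.
- by move=> _ [q [c'q cq] <-]; rewrite /= cmapK// /extend_fun asboolT.
- apply: (@Ck_on_comp _ _ _ _ k _ setT) => //; first exact: open_overlap.
  exact: atlas_smooth.
Qed.

Lemma smooth_extend_vfield e : smooth_vfield (extend_vfield e).
Proof.
move=> c' ac' k; apply: chart_cases => //; last first.
  move=> x c'x Hx; rewrite /= /extend_vfield; case: asboolP => [cx|_].
    by rewrite (Hx cx) scale0r of_components0 components0.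
  by rewrite components0.
have oc := @open_overlap _ _ _ c' c.
have oc' := @open_overlap _ _ _ c c'.
have tS : smooth_on (c' @` (cdom c' `&` cdom c)) (c \o cinv c').
  exact: atlas_smooth.
apply: (@Ck_on_eq _ _ _ _ _
  (fun x => \row_i ((H \o (c \o cinv c')) x *
    ((fun y => ('D_e (c' \o cinv c) y) 0 i) \o (c \o cinv c')) x))) => //.
  move=> _ [q [c'q cq] <-]; rewrite /= (cmapK c'q) /extend_vfield asboolT//.
  rewrite components_of//; apply/rowP => i; rewrite mxE.
  rewrite linearZ mxE deriveE//.
  exact: diff_transition.
apply: Ck_on_row => // i.
rewrite (_ : (fun x => _) = fun x => (H \o (c \o cinv c')) x *
    ((fun y => ('D_e (c' \o cinv c) y) 0 i) \o (c \o cinv c')) x); last first.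
  by apply/funext => x; rewrite mxE.
apply: Ck_onM => //; first exact: (@Ck_on_comp _ _ _ _ k _ setT).
apply: (@Ck_on_comp _ _ _ _ k _ (c @` (cdom c `&` cdom c'))) => //.
  by move=> _ [q [c'q cq] <-] /=; rewrite cmapK//; exists q.
apply: Ck_on_coord => //.
by have [_ dk] := atlas_smooth ac ac' k.+1; exact: dk.
Qed.

End Supported.
End Extension.

Section Abundance.
Variables (R : realType) (m : nat) (M : manifold R m).

(** A constant field in a chart, cut off by a bump function. *)
Lemma vfield_through (p : M) (v : 'rV[R]_m) :
  exists2 X, smooth_vfield X & X p = v.
Proof.
have ac := chart_at_atlas p; have cp := chart_at_dom p.
have [r r0 rimg] := chart_ball cp.
pose b := bump_fun (chart_at p p) r.
exists (extend_vfield (chart_at p) b ((b (chart_at p p))^-1 *: v)).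
  apply: (smooth_extend_vfield ac r0 rimg) => [k|y].
    exact: Ck_on_bump.
  exact: bump_out.
rewrite /extend_vfield asboolT// scalerA divff; last first.
  by rewrite gt_eqF// bump_center.
by rewrite scale1r of_components_chart_at.
Qed.

(** The test functions are the coordinates centred at p, cut off by a bump
function: their derivative at p only involves the value of the cut-off. *)
Lemma dirder_inj (p : M) (X Y : M -> 'rV[R]_m) :
  (forall f, smooth_fun f -> dirder X f p = dirder Y f p) -> X p = Y p.
Proof.
have ac := chart_at_atlas p; have cp := chart_at_dom p.
have [r r0 rimg] := chart_ball cp.
set a := chart_at p p in rimg.
pose b := bump_fun a r.
have bk k : Ck_on setT k b by exact: Ck_on_bump.
have oT := openT : open [set: 'rV[R]_m].
move=> XY; apply/rowP => i.
have xk k : Ck_on setT k (fun y : 'rV[R]_m => y 0 i + - a 0 i).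
  apply: Ck_onD => //; last exact: Ck_on_cst.
  exact: (Ck_on_coord oT i (@Ck_on_id _ _ _ k)).
pose H y := b y * (y 0 i + - a 0 i).
have HS : smooth_fun (extend_fun (chart_at p) H).
  apply: (smooth_extend_fun ac r0 rimg) => [k|y ry]; first exact: Ck_onM.
  by rewrite /H /b bump_out// mul0r.
have dH v : 'D_v H a = b a * v 0 i.
  have [bd _] := bk 1%N; have [xd _] := xk 1%N.
  have dx : 'D_v (fun y : 'rV[R]_m => y 0 i + - a 0 i) a = v 0 i.
    rewrite deriveD; last exact: derivable_cst.
      rewrite derive_cst addr0 deriveE; last exact: differentiable_coord.
      exact: diff_coord.
    exact/diff_derivable/differentiable_coord.
  rewrite [LHS](@deriveM _ _ b _ a v) ?dx; first by rewrite subrr scale0r addr0.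
    by apply: diff_derivable; exact: bd.
  by apply: diff_derivable; exact: xd.
have dE Z : dirder Z (extend_fun (chart_at p) H) p = b a * Z p 0 i.
  have HE : \forall y \near a,
      H y = (extend_fun (chart_at p) H \o cinv (chart_at p)) y.
    apply: filterS (overlap_near cp cp) => _ [q [cq _] <-] /=.
    by rewrite (cmapK cq) /extend_fun asboolT.
  have [Hd _] : Ck_on setT 1 H by exact: Ck_onM.
  have [_ E] := near_diff HE (Hd a I).
  rewrite -dH (deriveE _ (Hd a I)).
  exact: (congr1 (fun l : 'rV[R]_m -> R => l (Z p)) E).
have := XY _ HS; rewrite !dE => /mulfI; apply.
by rewrite gt_eqF// bump_center.
Qed.

End Abundance.

(** * The module of smooth vector fields *)

Section SmoothAlgebra.
Variables (R : realType) (m : nat) (M : manifold R m).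

Record sfun := SFun { sfun_val :> M -> R; sfunP : smooth_fun sfun_val }.

Record vfield := VField {
  vfield_val :> M -> 'rV[R]_m;
  vfieldP : smooth_vfield vfield_val
}.

Lemma sfun_eq (f f' : sfun) : (forall p, f p = f' p) -> f = f'.
Proof.
case: f f' => [f fS] [f' f'S] /= /funext ff'; subst f'.
by congr SFun; exact: Prop_irrelevance.
Qed.

Lemma vfield_eq (X Y : vfield) : (forall p, X p = Y p) -> X = Y.
Proof.
case: X Y => [X XS] [Y YS] /= /funext XY; subst Y.
by congr VField; exact: Prop_irrelevance.
Qed.

HB.instance Definition _ := gen_eqMixin sfun.
HB.instance Definition _ := gen_choiceMixin sfun.
HB.instance Definition _ := gen_eqMixin vfield.
HB.instance Definition _ := gen_choiceMixin vfield.

Definition sfun_cst a := SFun (@smooth_fun_cst R m M a).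
Definition sfun_add (f f' : sfun) := SFun (smooth_funD (sfunP f) (sfunP f')).
Definition sfun_mul (f f' : sfun) := SFun (smooth_funM (sfunP f) (sfunP f')).
Definition sfun_opp (f : sfun) := sfun_mul (sfun_cst (- 1)) f.

Fact sfun_addA : associative sfun_add.
Proof. by move=> f f' f''; apply: sfun_eq => p /=; rewrite addrA. Qed.
Fact sfun_addC : commutative sfun_add.
Proof. by move=> f f'; apply: sfun_eq => p /=; rewrite addrC. Qed.
Fact sfun_add0 : left_id (sfun_cst 0) sfun_add.
Proof. by move=> f; apply: sfun_eq => p /=; rewrite add0r. Qed.
Fact sfun_addN : left_inverse (sfun_cst 0) sfun_opp sfun_add.
Proof. by move=> f; apply: sfun_eq => p /=; rewrite mulN1r addNr. Qed.
HB.instance Definition _ :=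
  GRing.isZmodule.Build sfun sfun_addA sfun_addC sfun_add0 sfun_addN.

Fact sfun_mulA : associative sfun_mul.
Proof. by move=> f f' f''; apply: sfun_eq => p /=; rewrite mulrA. Qed.
Fact sfun_mulC : commutative sfun_mul.
Proof. by move=> f f'; apply: sfun_eq => p /=; rewrite mulrC. Qed.
Fact sfun_mul1 : left_id (sfun_cst 1) sfun_mul.
Proof. by move=> f; apply: sfun_eq => p /=; rewrite mul1r. Qed.
Fact sfun_mulD : left_distributive sfun_mul +%R.
Proof. by move=> f f' f''; apply: sfun_eq => p /=; rewrite mulrDl. Qed.
HB.instance Definition _ := GRing.Zmodule_isComPzRing.Build sfun
  sfun_mulA sfun_mulC sfun_mul1 sfun_mulD.

Definition vfield0 := VField (@smooth_vfield0 R m M).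
Definition vfield_add (X Y : vfield) :=
  VField (smooth_vfieldD (vfieldP X) (vfieldP Y)).
Definition vfield_scale (f : sfun) (X : vfield) :=
  VField (smooth_vfieldZ (sfunP f) (vfieldP X)).
Definition vfield_opp (X : vfield) := vfield_scale (sfun_cst (- 1)) X.

Fact vfield_addA : associative vfield_add.
Proof. by move=> X Y Z; apply: vfield_eq => p /=; rewrite addrA. Qed.
Fact vfield_addC : commutative vfield_add.
Proof. by move=> X Y; apply: vfield_eq => p /=; rewrite addrC. Qed.
Fact vfield_add0 : left_id vfield0 vfield_add.
Proof. by move=> X; apply: vfield_eq => p /=; rewrite add0r. Qed.
Fact vfield_addN : left_inverse vfield0 vfield_opp vfield_add.
Proof. by move=> X; apply: vfield_eq => p /=; rewrite scaleN1r addNr. Qed.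
HB.instance Definition _ :=
  GRing.isZmodule.Build vfield vfield_addA vfield_addC vfield_add0 vfield_addN.

Fact vfield_scaleA (f f' : sfun) X :
  vfield_scale f (vfield_scale f' X) = vfield_scale (f * f') X.
Proof. by apply: vfield_eq => p /=; rewrite scalerA. Qed.
Fact vfield_scale1 : left_id 1 vfield_scale.
Proof. by move=> X; apply: vfield_eq => p /=; rewrite scale1r. Qed.
Fact vfield_scaleDr : right_distributive vfield_scale +%R.
Proof. by move=> f X Y; apply: vfield_eq => p /=; rewrite scalerDr. Qed.
Fact vfield_scaleDl X : {morph vfield_scale^~ X : f f' / f + f'}.
Proof. by move=> f f'; apply: vfield_eq => p /=; rewrite scalerDl. Qed.
HB.instance Definition _ := GRing.Zmodule_isLmodule.Build sfun vfield
  vfield_scaleA vfield_scale1 vfield_scaleDr vfield_scaleDl.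

Lemma sfunNE (f : sfun) p : (- f) p = - f p.
Proof. exact: mulN1r. Qed.

Definition sfun_ev (p : M) (f : sfun) : R := f p.

Fact sfun_ev_additive p : zmod_morphism (sfun_ev p).
Proof. by move=> f f'; rewrite /sfun_ev /= mulN1r. Qed.
Fact sfun_ev_multiplicative p : monoid_morphism (sfun_ev p).
Proof. by []. Qed.
HB.instance Definition _ p :=
  GRing.isZmodMorphism.Build sfun R (sfun_ev p) (sfun_ev_additive p).
HB.instance Definition _ p :=
  GRing.isMonoidMorphism.Build sfun R (sfun_ev p) (sfun_ev_multiplicative p).

Definition vfield_der (X : vfield) (f : sfun) : sfun :=
  SFun (smooth_dirder (vfieldP X) (sfunP f)).

Lemma smooth_fun_diff (f : sfun) (p : M) :
  differentiable (f \o cinv (chart_at p)) (chart_at p p).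
Proof.
have [fd _] := sfunP f (chart_at_atlas p) 1%N.
by apply: fd; exists p => //; exact: chart_at_dom.
Qed.

Lemma vfield_derDl X Y f :
  vfield_der (X + Y) f = vfield_der X f + vfield_der Y f.
Proof. by apply: sfun_eq => p; exact: linearD. Qed.

Lemma vfield_derDr X f f' :
  vfield_der X (f + f') = vfield_der X f + vfield_der X f'.
Proof.
apply: sfun_eq => p; have fd := smooth_fun_diff f p.
have f'd := smooth_fun_diff f' p.
exact: (congr1 (fun l : 'rV[R]_m -> R => l (X p)) (diffD fd f'd)).
Qed.

Lemma vfield_derM X f f' :
  vfield_der X (f * f') = vfield_der X f * f' + f * vfield_der X f'.
Proof.
apply: sfun_eq => p; have fd := smooth_fun_diff f p.
have f'd := smooth_fun_diff f' p.
apply: (etrans (congr1 (fun l : 'rV[R]_m -> R => l (X p)) (diffM fd f'd))).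
have hE (h : sfun) : h (cinv (chart_at p) (chart_at p p)) = h p.
  by rewrite (cmapK (chart_at_dom p)).
transitivity (f p * vfield_der X f' p + f' p * vfield_der X f p).
  by congr (_ * _ + _ * _); exact: hE.
by rewrite addrC (mulrC (f' p)).
Qed.

Lemma vfield_der_inj X Y :
  (forall f, vfield_der X f = vfield_der Y f) -> X = Y.
Proof.
move=> XY; apply: vfield_eq => p; apply: dirder_inj => f fS.
by have := congr1 (fun h : sfun => h p) (XY (SFun fS)).
Qed.

End SmoothAlgebra.

(** * Connections and metrics on a manifold *)

(** Fewer linear forms than the dimension: a row of the kernel of the matrix of
their values on the basis is a common zero. *)
Lemma common_zero (R : realType) m (I : Type) (l : I -> 'rV[R]_m -> R)
    (s : seq I) : (forall i, scalar (l i)) -> (size s < m)%N ->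
  exists2 x : 'rV[R]_m, x != 0 &
    forall i : 'I_(size s), l (tnth (in_tuple s) i) x = 0.
Proof.
move=> l_lin sm.
pose A := \matrix_(j < m, i < size s) l (tnth (in_tuple s) i) (delta_mx 0 j).
have kn0 : kermx A != 0.
  rewrite -mxrank_eq0 mxrank_ker -lt0n subn_gt0.
  exact: leq_ltn_trans (rank_leq_col A) sm.
exists (nz_row (kermx A)); first by rewrite nz_row_eq0.
have /sub_kermxP xA := nz_row_sub (kermx A).
move: (nz_row _) xA => x xA i.
have := congr1 (fun B : 'rV[R]_(size s) => B 0 i) xA; rewrite !mxE => <-.
pose L := GRing.isLinear.Build _ _ _ _ _ (l_lin (tnth (in_tuple s) i)).
pose h : {scalar 'rV[R]_m} := HB.pack (l (tnth (in_tuple s) i)) L.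
rewrite -[LHS]/(h x) [LHS](linear_row_sum h x).
by apply: eq_bigr => j _; rewrite mxE.
Qed.

Section Connection.
Variables (R : realType) (m : nat) (M : manifold R m).
Variable nabla : (M -> 'rV[R]_m) -> (M -> 'rV[R]_m) -> M -> 'rV[R]_m.
Hypothesis conn : affine_connection nabla.
Implicit Types (f : sfun M) (X Y Z : vfield M).

Definition vfield_nabla X Y : vfield M :=
  VField (conn_smooth conn (vfieldP X) (vfieldP Y)).

Lemma vfield_nablaDl X Y Z :
  vfield_nabla (X + Y) Z = vfield_nabla X Z + vfield_nabla Y Z.
Proof.
apply: vfield_eq => p.
have := conn_linear conn (smooth_fun_cst (M := M) 1)
  (vfieldP X) (vfieldP Y) (vfieldP Z) p.
rewrite scale1r => E; apply: (etrans _ E) => {E} /=.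
by congr (nabla _ _ _); apply/funext => q; rewrite scale1r.
Qed.

Lemma vfield_nablaZl f X Y :
  vfield_nabla (f *: X) Y = f *: vfield_nabla X Y.
Proof.
have nabla0 : vfield_nabla 0 Y = 0.
  by apply: (addrI (vfield_nabla 0 Y)); rewrite -vfield_nablaDl !addr0.
apply: vfield_eq => p.
have := conn_linear conn (sfunP f) (vfieldP X) (smooth_vfield0 (M := M))
  (vfieldP Y) p.
have -> : nabla (fun=> 0) Y p = 0.
  exact: (congr1 (fun Z : vfield M => Z p) nabla0).
rewrite addr0 => E; apply: (etrans _ E) => {E} /=.
by congr (nabla _ _ _); apply/funext => q; rewrite addr0.
Qed.

Lemma vfield_nablaDr X Y Z :
  vfield_nabla X (Y + Z) = vfield_nabla X Y + vfield_nabla X Z.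
Proof.
by apply: vfield_eq => p; apply: conn_additive => //; exact: vfieldP.
Qed.

Lemma vfield_nablaZr f X Y : vfield_nabla X (f *: Y) =
  vfield_der X f *: Y + f *: vfield_nabla X Y.
Proof.
by apply: vfield_eq => p; apply: (conn_leibniz conn (sfunP f)); exact: vfieldP.
Qed.

End Connection.

Theorem theorem4p9 (R : realType) (n : nat) (M : manifold R (2 * n).+1)
    (g : M -> 'rV[R]_((2 * n).+1) -> 'rV[R]_((2 * n).+1) -> R)
    (phi : M -> {linear 'rV[R]_((2 * n).+1) -> 'rV[R]_((2 * n).+1)})
    (xi : M -> 'rV[R]_((2 * n).+1))
    (eta : M -> {scalar 'rV[R]_((2 * n).+1)})
    (nabla : (M -> 'rV[R]_((2 * n).+1)) -> (M -> 'rV[R]_((2 * n).+1)) ->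
             M -> 'rV[R]_((2 * n).+1))
    (hdim : (7 <= (2 * n).+1)%N)
    (hnabla : levi_civita g nabla)
    (hM : nearly_sasakian g phi xi eta nabla) :
  sasakian g phi xi eta nabla.
Proof.
have [acm ns] := hM; split=> // X0 Y0 X0S Y0S p.
have gm := acm_metric acm; have conn := lc_connection hnabla.
pose V := vfield M.
pose gV (X Y : V) : sfun M := SFun (smooth_metric gm (vfieldP X) (vfieldP Y)).
pose phiV (X : V) : V :=
  VField (smooth_endo_vfield (acm_phi_smooth acm) (vfieldP X)).
pose xiV : V := VField (acm_xi_smooth acm).
have g_lin q u v a w : g q (a *: u + v) w = a * g q u w + g q v w.
  by rewrite (Defs.metric_sym gm) (metric_linear gm) !(Defs.metric_sym gm q w).
have gVD (X Y Z : V) : gV (X + Y) Z = gV X Z + gV Y Z.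
  apply: sfun_eq => q; have := g_lin q (X q) (Y q) 1 (Z q).
  by rewrite scale1r mul1r.
have g0l q w : g q 0 w = 0.
  have := g_lin q 0 0 1 w; rewrite scale1r mul1r addr0 -[X in X = _]addr0.
  by move=> /addrI.
have gVZ (f : sfun M) (X Y : V) : gV (f *: X) Y = f * gV X Y.
  apply: sfun_eq => q; have := g_lin q (X q) 0 (f q) (Y q).
  by rewrite g0l !addr0.
have gV_def (X : V) : gV X X = 0 -> X = 0.
  move=> XX; apply: vfield_eq => q; apply: contrapT => /eqP Xq.
  have := metric_pos gm q Xq; suff -> : g q (X q) (X q) = 0 by rewrite ltxx.
  exact: (congr1 (fun f : sfun M => f q) XX).
have metric (X Y Z : V) : vfield_der X (gV Y Z) =
    gV (vfield_nabla conn X Y) Z + gV Y (vfield_nabla conn X Z).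
  by apply: sfun_eq => q; apply: (lc_metric hnabla); exact: vfieldP.
have tf (X Y : V) f :
    vfield_der (vfield_nabla conn X Y - vfield_nabla conn Y X) f =
    vfield_der X (vfield_der Y f) - vfield_der Y (vfield_der X f).
  apply: sfun_eq => q.
  have E := lc_torsion_free hnabla (vfieldP X) (vfieldP Y) (sfunP f) q.
  have WE : vfield_val (vfield_nabla conn X Y - vfield_nabla conn Y X) =
      fun q => nabla X Y q - nabla Y X q.
    by apply/funext => q'; rewrite /= scaleN1r.
  by rewrite -WE in E; apply: (etrans E); congr (_ + _); exact/esym/sfunNE.
have xi1 : gV xiV xiV = 1 by apply: sfun_eq => q; exact: (acm_xi_unit acm).
have phi2 (X : V) : phiV (phiV X) = - X + gV X xiV *: xiV.
  apply: vfield_eq => q; apply: (etrans (acm_phi2 acm (vfieldP X) q)).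
  by rewrite (acm_eta acm (vfieldP X)) /= scaleN1r.
have skew : skew_endo gV phiV.
  move=> X Y; apply: sfun_eq => q; rewrite sfunNE.
  by apply: (acm_phi_skew acm); exact: vfieldP.
have cov_derV (X Y : V) q : cov_der (vfield_nabla conn) phiV X Y q =
    nabla_endo nabla phi X Y q.
  by rewrite cov_derE /= scaleN1r.
have nearlyV (X : V) : cov_der (vfield_nabla conn) phiV X X =
    gV X X *: xiV - gV X xiV *: X.
  apply: vfield_eq => q; rewrite cov_derV (ns X (vfieldP X)).
  by rewrite (acm_eta acm (vfieldP X)) /= scaleN1r.
have room q (s : seq V) : (size s <= 5)%N -> exists2 X : V,
    forall Y, Y \in s -> sfun_ev q (gV X Y) = 0 & sfun_ev q (gV X X) <> 0.
  move=> s5.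
  have lin (Y : V) : scalar (fun v => g q v (Y q)).
    by move=> a u v; exact: g_lin.
  have [x x0 xs] := common_zero lin (leq_ltn_trans s5 (ltnW hdim)).
  have [X XS Xq] := vfield_through q x.
  exists (VField XS) => [Y /seq_tnthP[i ->]|]; rewrite /sfun_ev /= Xq.
    exact: xs.
  by apply/eqP; rewrite gt_eqF// metric_pos.
have gV_sym (X Y : V) : gV X Y = gV Y X.
  by apply: sfun_eq => q; exact: Defs.metric_sym.
have := nearly_sasakian_sasakian (ev := @sfun_ev R _ M) (@sfun_eq R _ M)
  (@vfield_derDl R _ M) (@vfield_derDr R _ M) (@vfield_derM R _ M)
  (@vfield_der_inj R _ M) (vfield_nablaDl conn) (vfield_nablaZl conn)
  (vfield_nablaDr conn) (vfield_nablaZr conn) tf gVD gVZ gV_sym gV_def metric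
  xi1 phi2 skew nearlyV room (VField X0S) (VField Y0S).
move=> /(congr1 (fun X : V => X p)); rewrite cov_derV => ->.
by rewrite (acm_eta acm Y0S) /= scaleN1r.
Qed.
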